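(* Let $K$ be an algebraically closed field of arbitrary characteristic. For $n\geq 1$ let $C_n$ be the set of all coordinates of degree $n$ of $K[x,y]$, regarded as a subset of the affine space of polynomials in $K[x,y]$ of degree $\leq n$. Then $\dim(C_n)=n+3$ for all $n\geq 2$, and $\dim(C_1)=3$.
   Context: A polynomial $f\in K[x,y]$ is a coordinate if there is $g\in K[x,y]$ such that $(f,g)$ is a $K$-automorphism of $K[x,y]$, i.e. the $K$-endomorphism $x\mapsto f$, $y\mapsto g$ is an automorphism. Degree means total degree. Polynomials of degree $\leq n$ are identified with points of the affine space $K^{(n+1)(n+2)/2}$ via their coefficients. This space carries the Zariski topology, and the dimension of a subset is the dimension of its Zariski closure. *)

(* Defs.v *)
From mathcomp Require Import all_boot all_order all_algebra.
From mathcomp Require Import classical_sets.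
From mathcomp Require Import mpoly.

Set Implicit Arguments.
Unset Strict Implicit.
Unset Printing Implicit Defensive.

Import GRing.Theory.

Local Open Scope ring_scope.
Local Open Scope classical_set_scope.

Section ZariskiTopology.
Variables (K : closedFieldType) (N : nat).
Implicit Types (A B S Z : set 'rV[K]_N) (I : set {mpoly K[N]}).

Definition zero_locus I : set 'rV[K]_N :=
  [set v | forall p, I p -> p.@[v ord0] = 0].

Definition zariski_closed Z : Prop := exists I, Z = zero_locus I.

Definition zariski_closure S : set 'rV[K]_N := smallest zariski_closed S.

Definition zariski_irreducible Z : Prop :=
  Z !=set0 /\
  forall A B, zariski_closed A -> zariski_closed B ->
    Z `<=` A `|` B -> Z `<=` A \/ Z `<=` B.

(* When Z is Zariski closed, the closed subsets of the topological space Z are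
   exactly the closed subsets of the affine space that are contained in Z. *)
Definition has_irreducible_chain Z (d : nat) : Prop :=
  exists C : nat -> set 'rV[K]_N,
    (forall i, (i <= d)%N ->
      [/\ zariski_closed (C i), zariski_irreducible (C i) & C i `<=` Z]) /\
    (forall i, (i < d)%N -> C i `<` C i.+1).

Definition krull_dim_is Z (d : nat) : Prop :=
  has_irreducible_chain Z d /\
  forall e, has_irreducible_chain Z e -> (e <= d)%N.

Definition zariski_dim_is S (d : nat) : Prop :=
  krull_dim_is (zariski_closure S) d.

End ZariskiTopology.

Section Coordinates.
Variable K : closedFieldType.

Definition is_coordinate (f : {mpoly K[2]}) : Prop :=
  exists g : {mpoly K[2]},
    bijective (fun p : {mpoly K[2]} => p \mPo [tuple f; g]).

(* ['X_{1..2 < n.+1}] is the type of monomials of total degree at most [n]. *)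
Definition coef_space_dim (n : nat) : nat := #|{: 'X_{1..2 < n.+1}}|.

Definition coef_vector (n : nat) (f : {mpoly K[2]}) :
    'rV[K]_(coef_space_dim n) :=
  \row_(i < coef_space_dim n) f@_(enum_val i).

(* [msize f] is one plus the total degree of [f], for [f] nonzero. *)
Definition coordinates_of_degree (n : nat) : set 'rV[K]_(coef_space_dim n) :=
  [set coef_vector n f | f in [set f | is_coordinate f /\ msize f = n.+1]].

End Coordinates.

Arguments coordinates_of_degree : clear implicits.

Lemma coef_space_dimE (n : nat) :
  coef_space_dim n = (((n + 1) * (n + 2)) %/ 2)%N.
Proof.
pose h (m : 'X_{1..2 < n.+1}) : 'I_n.+1 * 'I_n.+1 :=
  (inord (m ord0), inord (m ord_max)).
pose P (p : 'I_n.+1 * 'I_n.+1) := (p.1 + p.2 < n.+1)%N.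
have deg2 (m : 'X_{1..2}) : mdeg m = (m ord0 + m ord_max)%N.
  rewrite mdegE 2!big_ord_recl big_ord0 addn0.
  by congr (_ + fun_of_multinom m _)%N; apply/val_inj.
have leh (m : 'X_{1..2 < n.+1}) : (m ord0 < n.+1)%N /\ (m ord_max < n.+1)%N.
  by have := bmdeg m; rewrite deg2 => lt; split;
    [apply: leq_ltn_trans lt; apply: leq_addr
    | apply: leq_ltn_trans lt; apply: leq_addl].
have injh : injective h.
  move=> m1 m2 [/(congr1 val) /= e0 /(congr1 val) /= e1].
  move: e0 e1; have [a1 b1] := leh m1; have [a2 b2] := leh m2.
  rewrite !inordK // => e0 e1; apply/val_inj/mnmP => i /=.
  by case: i => [[|[|//]] lti]; [move: e0 | move: e1];
    congr (_ = _); congr (fun_of_multinom _ _); apply/val_inj.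
have imh : codom h =i P.
  move=> [i j]; apply/codomP/idP => [[m ->]|ltij].
    rewrite unfold_in /P /=; have [a b] := leh m.
    by rewrite !inordK // -deg2 bmdeg.
  have ltm : (mdeg [multinom [tuple val i; val j]] < n.+1)%N.
    by rewrite deg2 !multinomE.
  exists (BMultinom ltm); rewrite /h /= !multinomE /=.
  by rewrite !(tnth_nth 0%N) /= !inord_val.
rewrite /coef_space_dim -(card_codom injh) (eq_card imh) -sum1_card.
rewrite -(pair_big_dep predT (fun i j : 'I_n.+1 => i + j < n.+1)%N
            (fun _ _ => 1%N)) /=.
under eq_bigr => i _.
  rewrite sum1_card (_ : #|_| = n.+1 - i)%N; last first.
    rewrite -[RHS]card_ord.
    have le : (n.+1 - i <= n.+1)%N by apply: leq_subr.
    rewrite -(card_codom (f := widen_ord le)); last first.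
      by move=> a b /(congr1 val) /= ?; apply/val_inj.
    apply: eq_card => j; rewrite unfold_in /=; apply/idP/codomP => [lt|[k ->]].
      have lt' : (j < n.+1 - i)%N by rewrite ltn_subRL.
      by exists (Ordinal lt'); apply/val_inj.
    by have := ltn_ord k; rewrite ltn_subRL.
  over.
rewrite -(big_mkord xpredT (fun i => n.+1 - i)%N) big_nat_rev /= add0n.
rewrite (eq_big_nat _ _ (F2 := succn)); last first.
  by move=> i /andP[_ lt]; rewrite subKn.
have -> : (\sum_(0 <= i < n.+1) i.+1 = \sum_(0 <= i < n.+2) i)%N.
  by rewrite [RHS]big_nat_recl // add0n.
by rewrite bin2_sum bin2 /= divn2 addn1 addn2 mulnC.
Qed.

Lemma coef_vector_inj (K : closedFieldType) (n : nat) (f g : {mpoly K[2]}) :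
  (msize f <= n.+1)%N -> (msize g <= n.+1)%N ->
  coef_vector n f = coef_vector n g -> f = g.
Proof.
move=> lef leg /rowP efg; apply/mpolyP => m.
have [ltm|lem] := ltnP (mdeg m) n.+1.
  by have := efg (enum_rank (BMultinom ltm)); rewrite !mxE enum_rankK.
by rewrite !memN_msupp_eq0 //; apply/negP => /msize_mdeg_lt lt;
  have := leq_trans lt (leq_trans _ lem); rewrite ltnn => /(_ _)/negP; apply.
Qed.

Lemma coef_vector_surj (K : closedFieldType) (n : nat)
    (v : 'rV[K]_(coef_space_dim n)) :
  exists2 f : {mpoly K[2]}, (msize f <= n.+1)%N & coef_vector n f = v.
Proof.
exists (\sum_(m : 'X_{1..2 < n.+1}) v ord0 (enum_rank m) *: 'X_[m]).
  apply: (leq_trans (msize_sum _ _ _)); apply/bigmax_leqP => m _.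
  apply: (leq_trans (msizeZ_le _ _)); rewrite mmeasureX; exact: bmdeg.
apply/rowP => i; rewrite mxE raddf_sum /= (bigD1 (enum_val i)) //= big1.
  by rewrite addr0 mcoeffZ mcoeffX eqxx mulr1 enum_valK.
move=> m /negPf ne; rewrite mcoeffZ mcoeffX.
have -> : (bmnm m == bmnm (enum_val i)) = false by exact: ne.
by rewrite mulr0.
Qed.

(* Main.v *)
Require Import Defs.
From HB Require Import structures.
From mathcomp Require Import all_boot all_order all_algebra.
From mathcomp Require Import boolp classical_sets.
From mathcomp Require Import mpoly.
From mathcomp Require Import zify ring.

(**
A coordinate f with partner g, and inverse (X, Y), gives a polynomial
deformation u = X(f, g + s), v = Y(f, g + s) of the identity with
f(u, v) = f. Taking weighted leading forms (with a suitable rational weight for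
s) produces a deformation U, V, again starting at x, y and not constant in s,
that fixes the leading form L of f; hence every factor of L is fixed. If L
contains a power of x and another monomial this forces
L = c (x^p - l y^q)^e, and U^p - l V^q = x^p - l y^q. Differentiating the last
identity with respect to x and y bounds the s-degrees of U and V and gives
p = 1 or q = 1, in every characteristic. This replaces the theorem of Jung and
van der Kulk: a coordinate of degree n >= 2 has the form f1(A + Q(l), l), where
(A, l) are linear coordinates depending on one parameter, Q has degree k >= 2
and no terms of degree < 2, and f1 is a coordinate of degree n / k. By
induction, C_n lies in finitely many polynomial families with at most n + 3
parameters (3 if n = 1), since k + n / k <= n when both factors are at least 2.

For a strictly increasing chain of irreducible closed sets, functions vanishing
on one member but not on the next are algebraically independent on the largest
member, so a union of families with M parameters contains no chain of length
exceeding M. Conversely e y + P(x + b y), with deg P <= n, is a family of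
coordinates with n + 3 parameters, and switching on these parameters one by one
gives a chain of length n + 3.
*)

Set Implicit Arguments.
Unset Strict Implicit.
Unset Printing Implicit Defensive.
Import GRing.Theory.
Local Open Scope ring_scope.

(** * Polynomial solutions of u^p - l v^q = x^p - l y^q *)

Section CoefficientwiseDerivation.
Variables (D : idomainType) (d : {additive D -> D}).
Hypothesis dM : forall a b, d (a * b) = d a * b + a * d b.
Implicit Types P Q u v : {poly D}.

Let dp : {poly D} -> {poly D} := map_poly d.

Lemma map_deriv_mul P Q : dp (P * Q) = dp P * Q + P * dp Q.
Proof.
apply/polyP => n; rewrite coef_map /= coefD !coefM raddf_sum /= -big_split /=.
by apply: eq_bigr => i _; rewrite dM !coef_map.
Qed.

Lemma map_deriv_exp P n : dp (P ^+ n.+1) = n.+1%:R *: (P ^+ n * dp P).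
Proof.
elim: n => [|n IHn]; first by rewrite expr1 expr0 mul1r scale1r.
rewrite exprS map_deriv_mul IHn [n.+2%:R]mulrS scalerDl scale1r -scalerAr.
by rewrite mulrA -exprS mulrC.
Qed.

Lemma size_map_deriv P : (size (dp P) <= size P)%N.
Proof. exact: size_poly. Qed.

Variables (x y l : D) (p q : nat).
Hypotheses (dx : d x = 1) (dy : d y = 0) (dl : d l = 0) (l0 : l != 0).
Hypothesis y0 : y != 0.

Lemma deriv_exp a n : d (a ^+ n.+1) = n.+1%:R * (a ^+ n * d a).
Proof.
elim: n => [|n IHn]; first by rewrite expr1 expr0 !mul1r.
rewrite exprS dM IHn [n.+2%:R]mulrS mulrDl mul1r exprS.
by move: (n.+1%:R) => N; ring.
Qed.

Variables (u v : {poly D}).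
Hypothesis uv : u ^+ p.+1 - l *: v ^+ q.+1 = (x ^+ p.+1 - l * y ^+ q.+1)%:P.

Lemma deriv_fermat :
  p.+1%:R *: (u ^+ p * dp u) - (l * q.+1%:R) *: (v ^+ q * dp v) =
  (p.+1%:R * x ^+ p)%:P.
Proof.
have dpB a b : dp (a - b) = dp a - dp b by exact: raddfB.
have := congr1 dp uv; rewrite dpB map_deriv_exp.
rewrite -[l *: _]mul_polyC map_deriv_mul map_deriv_exp.
have dpC a : dp a%:P = (d a)%:P.
  by apply/polyP => i; rewrite coef_map !coefC; case: eqP => //; rewrite raddf0.
rewrite !dpC dl polyC0 mul0r add0r mul_polyC scalerA => ->; congr _%:P.
by rewrite raddfB /= dM dl mul0r add0r !deriv_exp dx dy !mulr0 subr0 mulr1.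
Qed.

Hypothesis u_0 : u`_0 = x.

(** Multiply [deriv_fermat] by [u] and replace [h] by the left side of [uv]: the terms in
    [u ^+ p.+1] cancel, so [v ^+ q] divides a nonzero multiple of [R], whose degree in s is at most
    that of [u]. The constant term of [R] is [- l * y ^+ q.+1], hence [R] is nonzero. *)
Lemma fermat_size_le : p.+1%:R != 0 :> D ->
  (q * (size v).-1 <= (size u).-1)%N.
Proof.
move=> p0; pose h := x ^+ p.+1 - l * y ^+ q.+1.
pose R := h *: dp u - x ^+ p *: u.
have eqR : p.+1%:R *: R =
    v ^+ q * ((l * q.+1%:R) *: (u * dp v) - (p.+1%:R * l) *: (v * dp u)).
  have e1 := deriv_fermat; have e2 := uv; rewrite -/h in e2.
  move: e1; rewrite -![_ *: (_ * _)]mul_polyC => e1.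
  rewrite /R; move: e2; rewrite -![_ *: _]mul_polyC !polyCM => e2.
  move: e1; rewrite !polyCM => e1.
  rewrite -e2.
  transitivity ((p.+1%:R)%:P * ((u ^+ p.+1 - l%:P * v ^+ q.+1) * dp u) -
     ((p.+1%:R)%:P * (x ^+ p)%:P) * u); first by ring.
  by rewrite -e1 !exprS; ring.
have R0 : R != 0.
  apply/eqP => /(congr1 (fun r : {poly D} => r`_0)).
  rewrite coef0 coefB !coefZ coef_map /= u_0 dx mulr1 -exprSr /h.
  rewrite addrC addKr => /eqP; rewrite oppr_eq0 mulf_eq0 (negPf l0) /=.
  by rewrite expf_eq0 (negPf y0) andbF.
have lR : (size (p.+1%:R *: R) <= size u)%N.
  rewrite size_scale //; apply: (leq_trans (size_polyD _ _)).
  rewrite size_polyN geq_max; apply/andP; split.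
    exact: leq_trans (size_scale_leq _ _) (size_map_deriv _).
  exact: size_scale_leq.
have R1 : p.+1%:R *: R != 0 by rewrite -size_poly_eq0 size_scale // size_poly_eq0.
move: lR R1; rewrite eqR; set w := (X in _ * X) => lR.
rewrite mulf_eq0 negb_or => /andP[v0 w0]; move: lR; rewrite size_mul //.
have := size_exp v q.
have : (0 < size w)%N by rewrite lt0n size_poly_eq0.
by lia.
Qed.

End CoefficientwiseDerivation.

Lemma coprime_natr_neq0 (R : nzRingType) p q :
  (0 < p)%N -> coprime p q -> p%:R = 0 :> R -> q%:R != 0 :> R.
Proof.
move=> p_gt0 /eqP cpq p0; apply/eqP => q0.
have [a _] := Bezoutl q p_gt0; rewrite cpq => /dvdnP[k /(congr1 (fun n => n%:R : R))].
rewrite natrD !natrM p0 q0 !mulr0 addr0 => /eqP.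
by rewrite oner_eq0.
Qed.

(* Comparing the s-degrees of u and v, for the two derivations, leaves only the
   exponents 2 and 2; in characteristic dividing an exponent one of the two
   differentiated equations already forces v or u to be constant in s. *)
Lemma fermat_polynomial_const (D : idomainType) (dx dy : {additive D -> D})
    (x y l m : D) (u v : {poly D}) (p q : nat) :
    (forall a b, dx (a * b) = dx a * b + a * dx b) ->
    (forall a b, dy (a * b) = dy a * b + a * dy b) ->
    dx x = 1 -> dx y = 0 -> dy x = 0 -> dy y = 1 ->
    dx l = 0 -> dy m = 0 -> l * m = 1 -> x != 0 -> y != 0 ->
    u`_0 = x -> v`_0 = y ->
    (1 < p)%N -> (1 < q)%N -> coprime p q ->
    u ^+ p - l *: v ^+ q = (x ^+ p - l * y ^+ q)%:P ->
  (size u <= 1)%N /\ (size v <= 1)%N.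
Proof.
move=> dxM dyM dxx dxy dyx dyy dxl dym lm x0 y0 u0 v0.
case: p q => [|p] [|q] // p1 q1 cpq uv.
have l0 : l != 0 by apply: contra_eq_neq lm => ->; rewrite mul0r eq_sym oner_eq0.
have m0 : m != 0 by apply: contra_eq_neq lm => ->; rewrite mulr0 eq_sym oner_eq0.
(* Dividing by - l exchanges the roles of [u] and [v], so both degree bounds come from the same
   lemma. *)
have vu : v ^+ q.+1 - m *: u ^+ p.+1 = (y ^+ q.+1 - m * x ^+ p.+1)%:P.
  have -> : v ^+ q.+1 - m *: u ^+ p.+1 = - m *: (u ^+ p.+1 - l *: v ^+ q.+1).
    by rewrite scalerBr scalerA mulNr mulrC lm scaleN1r opprK scaleNr addrC.
  rewrite uv -mul_polyC -polyCM; congr _%:P.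
  by rewrite mulNr mulrBr mulrA [m * l]mulrC lm mul1r opprB.
have sizes : (p.+1 * (size u).-1 = q.+1 * (size v).-1)%N.
  have : (size (u ^+ p.+1)).-1 = (size (l *: v ^+ q.+1)).-1.
    have addC (P : {poly D}) (c : D) : ((size (P + c%:P)%R).-1 <= (size P).-1)%N.
      have := size_polyD P c%:P; have := size_polyC_leq1 c.
      by move: (size (polyC c)) (size P) (size (P + _)) => a b d; lia.
    pose c := x ^+ p.+1 - l * y ^+ q.+1.
    have e1 : u ^+ p.+1 = l *: v ^+ q.+1 + c%:P by rewrite -uv addrC subrK.
    have e2 : l *: v ^+ q.+1 = u ^+ p.+1 + (- c)%:P by rewrite e1 polyCN addrK.
    apply/eqP; rewrite eqn_leq; apply/andP; split.
      by rewrite [X in (size (polyseq X)).-1]e1 addC.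
    by rewrite [X in (size (polyseq X)).-1]e2 addC.
  by rewrite size_scale // !size_exp mulnC => ->; rewrite mulnC.
suff [] : (size u).-1 = 0 \/ (size v).-1 = 0 by lia.
have [px0|px0] := eqVneq (p.+1%:R : D) 0.
  right.
  have qx0 := @coprime_natr_neq0 D p.+1 q.+1 isT cpq px0.
  have := deriv_fermat dyM dyy dyx dym vu.
  rewrite px0 mulr0 scale0r subr0 => e.
  have : (size (q.+1%:R *: (v ^+ q * map_poly dy v)) <= 1)%N.
    by rewrite e size_polyC_leq1.
  rewrite size_scale //.
  have : v ^+ q * map_poly dy v != 0.
    apply/eqP => e0; move: e; rewrite e0 scaler0 => /esym/eqP.
    by rewrite polyC_eq0 mulf_eq0 expf_eq0 (negPf y0) (negPf qx0) andbF.
  move=> nz; move: (nz); rewrite mulf_eq0 negb_or => /andP[a0 b0].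
  rewrite size_mul //; have := size_exp v q.
  move: b0; rewrite -size_poly_gt0; nia.
have [qx0|qx0] := eqVneq (q.+1%:R : D) 0.
  left.
  have := deriv_fermat dxM dxx dxy dxl uv.
  rewrite qx0 mulr0 scale0r subr0 => e.
  have : (size (p.+1%:R *: (u ^+ p * map_poly dx u)) <= 1)%N.
    by rewrite e size_polyC_leq1.
  rewrite size_scale //.
  have : u ^+ p * map_poly dx u != 0.
    apply/eqP => e0; move: e; rewrite e0 scaler0 => /esym/eqP.
    by rewrite polyC_eq0 mulf_eq0 expf_eq0 (negPf x0) (negPf px0) andbF.
  move=> nz; move: (nz); rewrite mulf_eq0 negb_or => /andP[a0 b0].
  rewrite size_mul //; have := size_exp u p.
  move: b0; rewrite -size_poly_gt0; nia.
have le1 := fermat_size_le dxM dxx dxy dxl l0 y0 uv u0 px0.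
have le2 := fermat_size_le dyM dyy dyx dym m0 x0 vu v0 qx0.
(* Here [p] and [q] are the exponents minus one: product 1 means that both exponents are 2, which
   coprimality forbids. *)
have [e|npq] := eqVneq (p * q)%N 1%N; last by nia.
have [ep eq] : p = 1%N /\ q = 1%N by nia.
by move: cpq; rewrite ep eq.
Qed.

(** * Weighted leading forms *)

Section BivariateEvaluation.
Variables (R S : comNzRingType) (h : {rmorphism R -> S}).
Implicit Types (a b : S) (f : {mpoly R[2]}).

(** With an arbitrary coefficient morphism [h], composition, substitution of a deformation and the
    weighted grading are all instances of this one ring morphism. *)
Definition eval2 a b f : S := mmap h (tnth [tuple a; b]) f.

HB.instance Definition _ a b :=
  GRing.RMorphism.copy (eval2 a b) (mmap h (tnth [tuple a; b])).

Lemma eval2E a b f :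
  eval2 a b f =
  \sum_(m <- msupp f) h f@_m * (a ^+ m ord0 * b ^+ m ord_max).
Proof.
rewrite /eval2 /mmap; apply: eq_bigr => m _; congr (_ * _).
rewrite /mmap1 big_ord_recl big_ord_recl big_ord0 mulr1.
by congr (_ * _ ^+ fun_of_multinom m _); apply/val_inj.
Qed.

Lemma eval2C a b c : eval2 a b c%:MP = h c.
Proof. exact: mmapC. Qed.

Lemma eval2Z a b c f : eval2 a b (c *: f) = h c * eval2 a b f.
Proof. exact: mmapZ. Qed.

Lemma eval2X a b : eval2 a b 'X_ord0 = a.
Proof. by rewrite /eval2 mmapX mmap1U. Qed.

Lemma eval2Y a b : eval2 a b 'X_ord_max = b.
Proof. by rewrite /eval2 mmapX mmap1U. Qed.

End BivariateEvaluation.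

Lemma mpoly_rmorph_ext (n : nat) (R : nzRingType) (S : nzRingType)
    (phi psi : {rmorphism {mpoly R[n]} -> S}) :
  (forall c, phi c%:MP = psi c%:MP) -> (forall i, phi 'X_i = psi 'X_i) ->
  phi =1 psi.
Proof.
move=> eqC eqX p; rewrite (mpolyE p) !rmorph_sum; apply: eq_bigr => m _.
rewrite -mul_mpolyC !rmorphM eqC mpolyXE_id !rmorph_prod; congr (_ * _).
by apply: eq_bigr => i _; rewrite !rmorphXn /= eqX.
Qed.

Lemma ord2P (i : 'I_2) : i = ord0 \/ i = ord_max.
Proof. by case: i => [[|[|//]] lti]; [left | right]; apply/val_inj. Qed.

Lemma rmorph_eval2 (R S T : comNzRingType) (h : {rmorphism R -> S})
    (k : {rmorphism S -> T}) (a b : S) (f : {mpoly R[2]}) :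
  k (eval2 h a b f) = eval2 (k \o h) (k a) (k b) f.
Proof.
rewrite !eval2E rmorph_sum; apply: eq_bigr => m _.
by rewrite !rmorphM !rmorphXn.
Qed.

Lemma eq_eval2 (R S : comNzRingType) (h h' : {rmorphism R -> S}) (a b : S)
    (f : {mpoly R[2]}) : h =1 h' -> eval2 h a b f = eval2 h' a b f.
Proof. by move=> eqh; rewrite !eval2E; apply: eq_bigr => m _; rewrite eqh. Qed.

Lemma comp_mpoly2E (R : comNzRingType) (u v f : {mpoly R[2]}) :
  f \mPo [tuple u; v] = eval2 (@mpolyC 2 R) u v f.
Proof. by []. Qed.

Lemma eval2_comp (R S : comNzRingType) (h : {rmorphism R -> S}) (a b : S)
    (u v f : {mpoly R[2]}) :
  eval2 h a b (f \mPo [tuple u; v]) =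
  eval2 h (eval2 h a b u) (eval2 h a b v) f.
Proof.
by rewrite comp_mpoly2E rmorph_eval2; apply: eq_eval2 => c; rewrite /= eval2C.
Qed.

Lemma eval2_id (R : comNzRingType) (f : {mpoly R[2]}) :
  eval2 (@mpolyC 2 R) 'X_ord0 'X_ord_max f = f.
Proof.
rewrite -comp_mpoly2E -[RHS]comp_mpoly_id; congr comp_mpoly.
by apply: eq_from_tnth => i; rewrite tnth_mktuple; case: (ord2P i) => ->.
Qed.

Definition mon2 (i j : nat) : 'X_{1..2} := [multinom [tuple i; j]].

Lemma mon2_0 i j : mon2 i j ord0 = i.
Proof. by rewrite multinomE. Qed.

Lemma mon2_1 i j : mon2 i j ord_max = j.
Proof. by rewrite multinomE. Qed.

Lemma mon2_inj (m m' : 'X_{1..2}) :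
  m ord0 = m' ord0 -> m ord_max = m' ord_max -> m = m'.
Proof. by move=> e0 e1; apply/mnmP => i; case: (ord2P i) => ->. Qed.

Lemma mon2E (m : 'X_{1..2}) : m = mon2 (m ord0) (m ord_max).
Proof. by apply: mon2_inj; rewrite ?mon2_0 ?mon2_1. Qed.

Lemma mdeg2E (m : 'X_{1..2}) : mdeg m = (m ord0 + m ord_max)%N.
Proof.
rewrite mdegE 2!big_ord_recl big_ord0 addn0.
by congr (_ + fun_of_multinom m _)%N; apply/val_inj.
Qed.

Lemma mpolyX2E (R : comNzRingType) (m : 'X_{1..2}) :
  'X_[m] = 'X_ord0 ^+ m ord0 * 'X_ord_max ^+ m ord_max :> {mpoly R[2]}.
Proof.
rewrite mpolyXE_id 2!big_ord_recl big_ord0 mulr1.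
have -> : lift ord0 ord0 = ord_max :> 'I_2 by apply/val_inj.
by [].
Qed.

Section WeightedComponents.
Variables (K : fieldType) (w1 w2 : nat).
Local Notation D := {mpoly K[2]}.
Local Notation x := ('X_ord0 : D).
Local Notation y := ('X_ord_max : D).
Local Notation iota := (polyC \o @mpolyC 2 K).

Definition wdeg (m : 'X_{1..2}) := (w1 * m ord0 + w2 * m ord_max)%N.

(* The weighted components of [f] are the coefficients of [grade f]. *)
Definition grade : D -> {poly D} :=
  eval2 iota (x%:P * 'X^w1) (y%:P * 'X^w2).

HB.instance Definition _ :=
  GRing.RMorphism.copy grade (eval2 iota (x%:P * 'X^w1) (y%:P * 'X^w2)).

Lemma gradeM f g : grade (f * g) = grade f * grade g.
Proof. exact: rmorphM. Qed.

Lemma gradeX f n : grade (f ^+ n) = grade f ^+ n.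
Proof. exact: rmorphXn. Qed.

Lemma grade0 : grade 0 = 0.
Proof. exact: rmorph0. Qed.

Lemma gradeE f :
  grade f = \sum_(m <- msupp f) (f@_m *: 'X_[m])%:P * 'X^(wdeg m).
Proof.
rewrite /grade eval2E; apply: eq_bigr => m _.
rewrite -mul_mpolyC polyCM /= -mulrA; congr (_ * _).
rewrite (mpolyX2E _ m) polyCM !rmorphXn /= /wdeg exprD !exprM !exprMn.
by rewrite mulrACA.
Qed.

Lemma coef_gradeE f d :
  (grade f)`_d = \sum_(m <- msupp f | wdeg m == d) f@_m *: 'X_[m].
Proof.
rewrite gradeE coef_sum [RHS]big_mkcond; apply: eq_bigr => m _.
by rewrite coefCM coefXn eq_sym; case: eqP; rewrite ?mulr1 ?mulr0.
Qed.

Lemma mcoeff_grade f d m :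
  ((grade f)`_d)@_m = if wdeg m == d then f@_m else 0.
Proof.
rewrite coef_gradeE raddf_sum /= -big_filter.
have [mf|mf] := boolP (m \in [seq m <- msupp f | wdeg m == d]); last first.
  rewrite big_seq big1.
    move: mf; rewrite mem_filter negb_and; case: eqP => //= _.
    by move/memN_msupp_eq0 ->.
  move=> m' m'f; rewrite mcoeffZ mcoeffX.
  by case: eqP => [e|_]; rewrite ?mulr0 //; rewrite -e m'f in mf.
rewrite (bigD1_seq m) ?filter_uniq ?msupp_uniq //= big1 => [|m' /negPf ne].
  rewrite addr0 mcoeffZ mcoeffX eqxx mulr1.
  by move: mf; rewrite mem_filter => /andP[-> _].
by rewrite mcoeffZ mcoeffX ne mulr0.
Qed.

Lemma size_gradeP f d :
  reflect (forall m, m \in msupp f -> (wdeg m <= d)%N)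
          (size (grade f) <= d.+1)%N.
Proof.
apply: (iffP idP) => [sz m|sz].
  rewrite mcoeff_msupp leqNgt; apply: contraNN => lt.
  have := mcoeff_grade f (wdeg m) m; rewrite eqxx => <-.
  by rewrite nth_default ?mcoeff0 // (leq_trans sz).
apply/leq_sizeP => j lt; apply/mpolyP => m; rewrite mcoeff_grade mcoeff0.
case: eqP => // e; apply/memN_msupp_eq0/negP => /sz.
by rewrite e leqNgt lt.
Qed.

Lemma eval2_coef_grade (S : comNzRingType) (h : {rmorphism K -> S}) a b f d :
  eval2 h a b (grade f)`_d =
  \sum_(m <- msupp f | wdeg m == d)
     h f@_m * (a ^+ m ord0 * b ^+ m ord_max).
Proof.
rewrite coef_gradeE rmorph_sum; apply: eq_bigr => m _.
by rewrite /= eval2Z (mpolyX2E _ m) rmorphM !rmorphXn /= eval2X eval2Y.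
Qed.

End WeightedComponents.

Section GradeSizes.
Variable K : fieldType.
Local Notation D := {mpoly K[2]}.

Lemma size_grade_gt0 w1 w2 (f : D) : (0 < size (grade w1 w2 f))%N = (f != 0).
Proof.
rewrite size_poly_gt0; congr (~~ _); apply/eqP/eqP => [f0 | ->]; last exact: rmorph0.
apply/mpolyP => m; have := mcoeff_grade w1 w2 f (wdeg w1 w2 m) m.
by rewrite f0 eqxx coef0 !mcoeff0 => <-.
Qed.

Lemma size_gradeM w1 w2 (f g : D) : f != 0 -> g != 0 ->
  size (grade w1 w2 (f * g)) =
  ((size (grade w1 w2 f) + size (grade w1 w2 g)).-1)%N.
Proof.
move=> f0 g0.
have F0 : grade w1 w2 f != 0 by rewrite -size_poly_gt0 size_grade_gt0.
have G0 : grade w1 w2 g != 0 by rewrite -size_poly_gt0 size_grade_gt0.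
rewrite gradeM; move: (grade w1 w2 f) (grade w1 w2 g) F0 G0 => F G F0 G0.
by rewrite size_mul.
Qed.

(** A common factor in the weights only renumbers the components; this makes up for rational
    weights. *)
Lemma coef_grade_scale w1 w2 M (f : D) d : (0 < M)%N ->
  (grade (M * w1) (M * w2) f)`_(M * d) = (grade w1 w2 f)`_d.
Proof.
move=> M0; apply/mpolyP => m; rewrite !mcoeff_grade /wdeg -!mulnA -mulnDr.
by rewrite eqn_mul2l -[M == 0%N]negbK -lt0n M0.
Qed.

Lemma size_grade_scale w1 w2 M (f : D) d : (size (grade w1 w2 f) <= d.+1)%N ->
  (size (grade (M * w1) (M * w2) f) <= (M * d).+1)%N.
Proof.
move=> /size_gradeP le; apply/size_gradeP => m mf.
by rewrite /wdeg -!mulnA -mulnDr leq_mul2l le ?orbT.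
Qed.

End GradeSizes.

(** * Leading parts of polynomials in two graded variables *)

Section TopParts.
Variables (D : comNzRingType) (c : nat).
Implicit Types (P Q : {poly {poly D}}) (d e : nat).

(* The second variable of {poly {poly D}} is given the weight -c. *)
Definition top_le d P := forall i, (size (P`_i)%R <= (d + c * i).+1)%N.
Definition top d P : {poly D} := \poly_(i < size P) (P`_i)`_(d + c * i).

Lemma coef_top d P i : (top d P)`_i = (P`_i)`_(d + c * i).
Proof.
rewrite coef_poly; case: ltnP => // le.
by rewrite [P`_i]nth_default // coef0.
Qed.

Lemma coef_mul_top (p q : {poly D}) d e :
  (size p <= d.+1)%N -> (size q <= e.+1)%N -> (p * q)`_(d + e) = p`_d * q`_e.
Proof.
move=> lep leq; rewrite coefM.
have lt : (d < (d + e).+1)%N by rewrite ltnS leq_addr.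
rewrite (bigD1 (Ordinal lt)) //= addKn big1 ?addr0 // => i ne.
have {}ne : (i : nat) != d by apply: contraNneq ne => e'; apply/eqP/val_inj.
have [lti|gei] := ltnP d i.
  by rewrite [p`_i]nth_default ?mul0r // (leq_trans lep).
rewrite [q`_(_)]nth_default ?mulr0 // (leq_trans leq) //.
by have := ltn_ord i; lia.
Qed.

Lemma top_leM d e P Q : top_le d P -> top_le e Q -> top_le (d + e) (P * Q).
Proof.
move=> leP leQ n; rewrite coefM; apply/leq_sizeP => j lej.
rewrite coef_sum big1 // => i _; apply: nth_default.
apply: (leq_trans (size_polyMleq _ _)).
have := leP i; have := leQ (n - i)%N; have := ltn_ord i.
by move: (size _) (size _) => s t; nia.
Qed.

Lemma topM d e P Q : top_le d P -> top_le e Q ->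
  top (d + e) (P * Q) = top d P * top e Q.
Proof.
move=> leP leQ; apply/polyP => n; rewrite coef_top !coefM coef_sum.
apply: eq_bigr => i _; rewrite !coef_top.
have -> : (d + e + c * n = (d + c * i) + (e + c * (n - i)))%N.
  by have := ltn_ord i; nia.
by rewrite coef_mul_top.
Qed.

Lemma top_leX d P n : top_le d P -> top_le (d * n) (P ^+ n).
Proof.
move=> leP; elim: n => [|n IHn].
  rewrite expr0 muln0 => -[|i]; rewrite coef1 /=.
    by rewrite size_poly1.
  by rewrite size_poly0.
by rewrite exprS mulnS; apply: top_leM.
Qed.

Lemma topX d P n : top_le d P -> top (d * n) (P ^+ n) = (top d P) ^+ n.
Proof.
move=> leP; elim: n => [|n IHn]; last first.
  by rewrite !exprS mulnS topM ?IHn //; apply: top_leX.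
rewrite !expr0 muln0; apply/polyP => i; rewrite coef_top !coef1.
by case: i => [|i] /=; rewrite ?muln0 ?coef1 ?coef0.
Qed.

Lemma top_sum d (I : Type) (r : seq I) (F : I -> {poly {poly D}}) :
  top d (\sum_(i <- r) F i) = \sum_(i <- r) top d (F i).
Proof.
apply/polyP => i; rewrite coef_top !coef_sum.
by apply: eq_bigr => j _; rewrite coef_top.
Qed.

Lemma topC d (p : {poly D}) : top d p%:P = (p`_d)%:P.
Proof.
apply/polyP => i; rewrite coef_top !coefC.
by case: eqP => [->|_]; rewrite ?muln0 ?addn0 ?coef0.
Qed.

Lemma top_lt d e P : top_le d P -> (d < e)%N -> top e P = 0.
Proof.
move=> leP lt; apply/polyP => i; rewrite coef_top coef0 nth_default //.
by apply: (leq_trans (leP i)); rewrite ltn_add2r.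
Qed.

Lemma top_scale d (a : D) P : top d (a%:P%:P * P) = a%:P * top d P.
Proof.
by apply/polyP => i; rewrite coef_top !coefCM coef_top.
Qed.

End TopParts.

(** A monomial of weight below [W] cannot reach the bound [W] after substitution, so only the
    component of weight [W] contributes, and on it [top] is multiplicative. *)
Lemma top_eval2 (K : fieldType) (w1 w2 c W : nat) (f : {mpoly K[2]})
    (U V : {poly {poly {mpoly K[2]}}}) :
    (forall m, m \in msupp f -> (wdeg w1 w2 m <= W)%N) ->
    top_le c w1 U -> top_le c w2 V ->
  top c W (eval2 (polyC \o (polyC \o @mpolyC 2 K)) U V f) =
  eval2 (polyC \o @mpolyC 2 K) (top c w1 U) (top c w2 V) (grade w1 w2 f)`_W.
Proof.
move=> lef leU leV; rewrite eval2_coef_grade eval2E top_sum.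
rewrite [RHS]big_mkcond /= big_seq [RHS]big_seq; apply: eq_bigr => m mf.
rewrite top_scale.
have leUV := top_leM (top_leX (m ord0) leU) (top_leX (m ord_max) leV).
case: eqP => [<-|ne].
  by rewrite topM ?topX //; apply: top_leX.
rewrite (top_lt leUV) ?mulr0 // -/(wdeg w1 w2 m).
by rewrite ltn_neqAle lef // andbT; apply/eqP.
Qed.

Lemma coef_comp_scaleX (R : comNzRingType) (p : {poly R}) (a : R) i :
  (p \Po (a *: 'X))`_i = p`_i * a ^+ i.
Proof.
rewrite comp_polyE coef_sum.
under eq_bigr do rewrite exprZn scalerA coefZ coefXn.
have [lt|ge] := ltnP i (size p); last first.
  rewrite [p`_i]nth_default // mul0r big1 // => j _.
  by rewrite gtn_eqF ?mulr0 // (leq_trans (ltn_ord j)).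
rewrite (bigD1 (Ordinal lt)) //= eqxx mulr1 big1 ?addr0 // => j ne.
by rewrite [_ == _](_ : _ = false) ?mulr0 // eq_sym; apply/negbTE.
Qed.

(** * Deformations that fix a polynomial *)

Section Deformations.
Variable K : fieldType.
Local Notation D := {mpoly K[2]}.
Local Notation x := ('X_ord0 : D).
Local Notation y := ('X_ord_max : D).
Local Notation iota := (polyC \o @mpolyC 2 K).

(* A coordinate is fixed by moving its partner by the parameter. *)
Definition has_deformation (f : D) : Prop :=
  exists u v : {poly D},
    [/\ u`_0 = x, v`_0 = y, eval2 iota u v f = f%:P &
        ~ ((size u <= 1)%N /\ (size v <= 1)%N)].

(* Rescaling the deformation parameter by a power of x and the weights by a
   factorial makes the optimal slope [c] a natural number. *)
Lemma leading_form_deformation (f : D) (w1 w2 W : nat) :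
    has_deformation f -> (0 < w1)%N -> (0 < w2)%N ->
    (forall m, m \in msupp f -> (wdeg w1 w2 m <= W)%N) ->
  has_deformation (grade w1 w2 f)`_W.
Proof.
move=> [u0 [v0 [u0_0 v0_0 fuv0 nconst]]] w1_gt0 w2_gt0 lef; pose a : D := x ^+ (w1 + w2).
(* Replacing s by a s raises the weight of every nonzero coefficient of positive index above both
   [w1] and [w2]. *)
pose u := u0 \Po (a *: 'X); pose v := v0 \Po (a *: 'X).
have fuv : eval2 iota u v f = f%:P.
  rewrite -[RHS](comp_polyC _ (a *: 'X)) -fuv0.
  rewrite [RHS](rmorph_eval2 _ (comp_poly (a *: 'X))) /=.
  by apply: eq_eval2 => t; rewrite /= comp_polyC.
pose S := maxn (size u0) (size v0).
(* A factorial is divisible by all indices that occur, so the slopes become natural numbers after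
   multiplication by [M]. *)
have [M M_gt0 dvM] : exists2 M, (0 < M)%N &
    forall i, (0 < i)%N -> (i < S)%N -> (M %/ i * i = M)%N.
  exists S`!; first exact: fact_gt0.
  by move=> i i0 iS; rewrite divnK // dvdn_fact // i0 ltnW.
pose gr (P : D) := size (grade w1 w2 P).
(* [ex] is the excess of a weight over [w], cut off at 0, and [slope i] is [M] times the larger
   excess per power of s. The index 0 contributes 0, since [M %/ 0] is 0. *)
pose ex (w : nat) (P : D) := ((gr P).-1 - w)%N.
pose slope i := (maxn (ex w1 (u`_i)%R) (ex w2 (v`_i)%R) * (M %/ i))%N.
pose c := (\max_(i < S) slope i)%N.
have coefu i : u`_i = u0`_i * a ^+ i by rewrite coef_comp_scaleX.
have coefv i : v`_i = v0`_i * a ^+ i by rewrite coef_comp_scaleX.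
have szu i : (S <= i)%N -> u`_i = 0.
  move=> le; rewrite coefu nth_default ?mul0r //.
  by rewrite (leq_trans _ le) // leq_maxl.
have szv i : (S <= i)%N -> v`_i = 0.
  move=> le; rewrite coefv nth_default ?mul0r //.
  by rewrite (leq_trans _ le) // leq_maxr.
have u_0 : u`_0 = x by rewrite coefu u0_0 expr0 mulr1.
have v_0 : v`_0 = y by rewrite coefv v0_0 expr0 mulr1.
have grx : gr x = w1.+1.
  rewrite /gr /grade eval2X size_Cmul ?size_polyXn //.
  by rewrite -msize_poly_eq0 msizeX.
have gry : gr y = w2.+1.
  rewrite /gr /grade eval2Y size_Cmul ?size_polyXn //.
  by rewrite -msize_poly_eq0 msizeX.
have slope_le i : (0 < i)%N -> (i < S)%N ->
    (M * maxn (ex w1 (u`_i)%R) (ex w2 (v`_i)%R) <= c * i)%N.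
  move=> i0 iS; rewrite -{1}(dvM i i0 iS) mulnAC leq_mul2r; apply/orP; right.
  by rewrite mulnC; apply: (leq_bigmax (Ordinal iS)).
pose U1 : {poly {poly D}} := map_poly (grade (M * w1) (M * w2)) u.
pose V1 : {poly {poly D}} := map_poly (grade (M * w1) (M * w2)) v.
have le_top (w i : nat) (P : D) : (M * ex w P <= c * i)%N ->
    (size (grade (M * w1) (M * w2) P) <= (M * w + c * i).+1)%N.
  move=> le; apply: (@leq_trans (M * (gr P).-1).+1); last by rewrite /ex in le; nia.
  apply: size_grade_scale; rewrite -/(gr P); exact: leqSpred.
have leU : top_le c (M * w1) U1.
  move=> i; rewrite coef_map; apply: le_top.
  have [/szu->|iS] := leqP S i; first by rewrite /ex /gr grade0 size_poly0 muln0.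
  have [->|i0] := posnP i; first by rewrite u_0 /ex grx subnn muln0.
  by apply: leq_trans (slope_le _ i0 iS); rewrite leq_mul2l leq_maxl orbT.
have leV : top_le c (M * w2) V1.
  move=> i; rewrite coef_map; apply: le_top.
  have [/szv->|iS] := leqP S i; first by rewrite /ex /gr grade0 size_poly0 muln0.
  have [->|i0] := posnP i; first by rewrite v_0 /ex gry subnn muln0.
  by apply: leq_trans (slope_le _ i0 iS); rewrite leq_mul2l leq_maxr orbT.
have lead_neq0 (P : D) : P != 0 -> (grade (M * w1) (M * w2) P)`_(M * (gr P).-1) != 0.
  move=> P0; rewrite coef_grade_scale // -lead_coefE lead_coef_eq0.
  by rewrite -size_poly_gt0 size_grade_gt0.
have gr_a i : (0 < i)%N -> (w1 + w2 < gr (a ^+ i)%R)%N.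
  move=> i0; rewrite /gr gradeX /a gradeX -exprM {1}/grade eval2X.
  rewrite exprMn -exprM -rmorphXn size_Cmul.
    by rewrite size_polyXn ltnS mulnCA leq_pmulr // muln_gt0 w1_gt0.
  by rewrite expf_neq0 // -msize_poly_eq0 msizeX.
have gr_big (P : D) i : P != 0 -> (0 < i)%N -> (w1 + w2 < gr (P * a ^+ i)%R)%N.
  move=> P0 i0; have gra := gr_a i i0.
  have P0' : (0 < gr P)%N by rewrite /gr size_grade_gt0.
  have ai0 : a ^+ i != 0.
    by rewrite -(size_grade_gt0 w1 w2) (leq_ltn_trans _ gra).
  have -> : gr (P * a ^+ i)%R = (gr P + gr (a ^+ i)%R).-1 by apply: size_gradeM.
  by apply: (leq_trans gra); rewrite -subn1 -addnBAC // leq_addl.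
have [i [i0 iS uv0]] : exists i, [/\ (0 < i)%N, (i < S)%N & (u`_i != 0) || (v`_i != 0)].
  have a0 : a != 0 by rewrite expf_neq0 // -msize_poly_eq0 msizeX.
  have [lt|] := ltnP 1 (size u0).
    exists (size u0).-1; split; first by lia.
      by rewrite /S; lia.
    have n0 : u0`_(size u0).-1 != 0.
      by rewrite -lead_coefE lead_coef_eq0 -size_poly_gt0 ltnW.
    by apply/orP; left; rewrite coefu; apply: (mulf_neq0 n0); apply: expf_neq0.
  have [lt _|] := ltnP 1 (size v0); last by move=> ? ?; case: nconst.
  exists (size v0).-1; split; first by lia.
    by rewrite /S; lia.
  have n0 : v0`_(size v0).-1 != 0.
    by rewrite -lead_coefE lead_coef_eq0 -size_poly_gt0 ltnW.
  by apply/orP; right; rewrite coefv; apply: (mulf_neq0 n0); apply: expf_neq0.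
(* The rescaling gives the nonzero coefficient at [i] a positive excess. Positivity of [c] keeps the
   index attaining the maximum away from 0. *)
have c_gt0 : (0 < c)%N.
  have := slope_le i i0 iS.
  suff : (0 < maxn (ex w1 (u`_i)%R) (ex w2 (v`_i)%R))%N by nia.
  have /orP[n0|n0] := uv0; rewrite leq_max; apply/orP; [left|right].
    have /andP[n0' _] : (u0`_i != 0) && (a ^+ i != 0) by rewrite -negb_or -mulf_eq0 -coefu.
    by have := gr_big _ i n0' i0; rewrite -coefu /ex; move: (gr _) => s; lia.
  have /andP[n0' _] : (v0`_i != 0) && (a ^+ i != 0) by rewrite -negb_or -mulf_eq0 -coefv.
  by have := gr_big _ i n0' i0; rewrite -coefv /ex; move: (gr _) => s; lia.
exists (top c (M * w1) U1), (top c (M * w2) V1); split.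
- rewrite coef_top coef_map muln0 addn0 /= u_0 coef_grade_scale //.
  by rewrite /grade eval2X coefCM coefXn eqxx mulr1.
- rewrite coef_top coef_map muln0 addn0 /= v_0 coef_grade_scale //.
  by rewrite /grade eval2Y coefCM coefXn eqxx mulr1.
- rewrite -(coef_grade_scale _ _ _ _ M_gt0) -top_eval2 //; last first.
    by move=> m mf; rewrite /wdeg -!mulnA -mulnDr leq_mul2l lef ?orbT.
  rewrite -(topC c); congr top.
  transitivity (map_poly (grade (M * w1) (M * w2)) (eval2 iota u v f)).
    have := rmorph_eval2 iota (map_poly (grade (M * w1) (M * w2))) u v f.
    move=> /= ->; apply: eq_eval2 => t.
    by rewrite /= map_polyC /= /grade eval2C.
  by rewrite fuv map_polyC.
(* Where the maximum is attained, the leading form of the coefficient of [u] or of [v] survives in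
   [top], so the new deformation is not constant. *)
have [i1 e1] : exists i1 : 'I_S, c = slope i1.
  have S_gt0 : (0 < #|'I_S|)%N by rewrite card_ord (leq_ltn_trans _ iS).
  by have [i1 e1] := @eq_bigmax 'I_S (fun i => slope i) S_gt0; exists i1.
have i1_gt0 : (0 < i1)%N.
  by rewrite lt0n; apply: contraTneq c_gt0 => e; rewrite e1 /slope e divn0 muln0.
have eM : (M * maxn (ex w1 (u`_i1)%R) (ex w2 (v`_i1)%R) = c * i1)%N.
  rewrite e1 /slope -mulnA (dvM i1 i1_gt0 (ltn_ord i1)).
  exact: mulnC.
have m_gt0 : (0 < maxn (ex w1 (u`_i1)%R) (ex w2 (v`_i1)%R))%N by nia.
have nz (P : {poly D}) : P`_i1 != 0 -> (size P <= 1)%N = false.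
  by move=> nz; apply: contraNF nz => le; rewrite nth_default // (leq_trans le).
move=> [sU sV]; move: m_gt0 eM; rewrite /maxn; case: ifP => _ m_gt0 eM.
  have := nz (top c (M * w2) V1); rewrite sV coef_top coef_map /=.
  rewrite -eM -mulnDr /ex subnKC; last by move: m_gt0; rewrite /ex; lia.
  rewrite lead_neq0 => [/(_ isT)//|]; apply: contraTneq m_gt0 => ->.
  by rewrite /ex /gr grade0 size_poly0.
have := nz (top c (M * w1) U1); rewrite sU coef_top coef_map /=.
rewrite -eM -mulnDr /ex subnKC; last by move: m_gt0; rewrite /ex; lia.
rewrite lead_neq0 => [/(_ isT)//|]; apply: contraTneq m_gt0 => ->.
by rewrite /ex /gr grade0 size_poly0.
Qed.

End Deformations.

(** * Coordinates and their inverses *)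

Section Coordinates.
Variable K : fieldType.
Local Notation D := {mpoly K[2]}.
Local Notation x := ('X_ord0 : D).
Local Notation y := ('X_ord_max : D).
Local Notation iota := (polyC \o @mpolyC 2 K).

Definition inverse_pairs (f g X Y : D) : Prop :=
  [/\ X \mPo [tuple f; g] = x, Y \mPo [tuple f; g] = y,
      f \mPo [tuple X; Y] = x & g \mPo [tuple X; Y] = y].

(** The explicit inverse replaces bijectivity of the substitution; [coordinateP] shows that the two
    notions agree. *)
Definition coord (f : D) : Prop := exists g X Y, inverse_pairs f g X Y.

Lemma comp_mpoly2X (a b : D) : x \mPo [tuple a; b] = a.
Proof. by rewrite comp_mpoly2E eval2X. Qed.

Lemma comp_mpoly2Y (a b : D) : y \mPo [tuple a; b] = b.
Proof. by rewrite comp_mpoly2E eval2Y. Qed.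

Lemma comp_mpoly2_id (f : D) : f \mPo [tuple x; y] = f.
Proof. by rewrite comp_mpoly2E eval2_id. Qed.

Lemma comp_mpoly2A (f a b c d : D) :
  f \mPo [tuple a; b] \mPo [tuple c; d] =
  f \mPo [tuple a \mPo [tuple c; d]; b \mPo [tuple c; d]].
Proof. exact: eval2_comp. Qed.

(** Let [e] send P to P(f, g + s). Then f(e X, e Y) = e x = f, while g(e X, e Y) = g + s prevents
    [e X] and [e Y] from both being constant in s. *)
Lemma coord_deformation (f : D) : coord f -> has_deformation f.
Proof.
move=> [g [X [Y [Xx Yy fx gy]]]].
pose e := eval2 iota f%:P (g%:P + 'X).
have horner0 : forall P, (e P)`_0 = P \mPo [tuple f; g].
  move=> P; rewrite -horner_coef0 /e -[_.[0]]/(horner_eval 0 _) rmorph_eval2.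
  rewrite comp_mpoly2E /= /horner_eval !hornerE.
  by apply: eq_eval2 => c; rewrite /= /horner_eval hornerC.
have eX P : eval2 iota (e X) (e Y) P = e (P \mPo [tuple X; Y]).
  by rewrite /e eval2_comp.
exists (e X), (e Y); split; rewrite ?horner0 //.
  by rewrite eX fx /e eval2X.
move=> [/size1_polyC eXc /size1_polyC eYc].
have eg : eval2 iota (e X) (e Y) g = g%:P + 'X by rewrite eX gy /e eval2Y.
have := congr1 (fun P : {poly D} => P`_1) eg.
rewrite /= eXc eYc coefD coefC coefX add0r.
have -> : eval2 iota ((e X)`_0)%:P ((e Y)`_0)%:P g =
          (eval2 (@mpolyC 2 K) (e X)`_0 (e Y)`_0 g)%:P.
  by rewrite [RHS](rmorph_eval2 _ (@polyC D)).
by rewrite coefC => /esym/eqP; rewrite oner_eq0.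
Qed.

Lemma coord_comp (f a b a' b' : D) :
  inverse_pairs a b a' b' -> coord f -> coord (f \mPo [tuple a; b]).
Proof.
move=> [a'x b'y ax by_] [g [X [Y [Xx Yy fx gy]]]].
have eX : X \mPo [tuple f \mPo [tuple a; b]; g \mPo [tuple a; b]] = a.
  by rewrite -[LHS]comp_mpoly2A Xx comp_mpoly2X.
have eY : Y \mPo [tuple f \mPo [tuple a; b]; g \mPo [tuple a; b]] = b.
  by rewrite -[LHS]comp_mpoly2A Yy comp_mpoly2Y.
have ea : a \mPo [tuple a' \mPo [tuple X; Y]; b' \mPo [tuple X; Y]] = X.
  by rewrite -[LHS]comp_mpoly2A ax comp_mpoly2X.
have eb : b \mPo [tuple a' \mPo [tuple X; Y]; b' \mPo [tuple X; Y]] = Y.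
  by rewrite -[LHS]comp_mpoly2A by_ comp_mpoly2Y.
exists (g \mPo [tuple a; b]), (a' \mPo [tuple X; Y]), (b' \mPo [tuple X; Y]).
split; rewrite [LHS]comp_mpoly2A.
- exact: etrans (congr2 (fun s t => a' \mPo [tuple s; t]) eX eY) a'x.
- exact: etrans (congr2 (fun s t => b' \mPo [tuple s; t]) eX eY) b'y.
- exact: etrans (congr2 (fun s t => f \mPo [tuple s; t]) ea eb) fx.
- exact: etrans (congr2 (fun s t => g \mPo [tuple s; t]) ea eb) gy.
Qed.

Lemma inverse_swap : inverse_pairs y x y x.
Proof. by split; rewrite (comp_mpoly2X, comp_mpoly2Y). Qed.

(** The hypothesis expresses that [p] does not involve x. *)
Lemma inverse_shear (p : D) : (forall a, p \mPo [tuple a; y] = p) ->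
  inverse_pairs (x + p) y (x - p) y.
Proof.
move=> ep; split; rewrite ?comp_mpoly2Y //.
  by rewrite comp_mpolyB comp_mpoly2X ep addrK.
by rewrite comp_mpolyD comp_mpoly2X ep subrK.
Qed.

End Coordinates.

Lemma coordinateP (K : closedFieldType) (f : {mpoly K[2]}) :
  is_coordinate f <-> coord f.
Proof.
split=> [[g bij_fg] | [g [X [Y [Xx Yy fx gy]]]]]; last first.
  by exists g; exists (fun p => p \mPo [tuple X; Y]) => p;
    rewrite comp_mpoly2A ?fx ?gy ?Xx ?Yy comp_mpoly2_id.
have inj_fg := bij_inj bij_fg; have [psi _ psiK] := bij_fg.
(* The preimages of x and y form the inverse; injectivity of the substitution yields the identities
   for the opposite order. *)
exists g, (psi 'X_ord0), (psi 'X_ord_max); split; rewrite ?psiK //; apply: inj_fg.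
  by rewrite comp_mpoly2A !psiK comp_mpoly2_id comp_mpoly2X.
by rewrite comp_mpoly2A !psiK comp_mpoly2_id comp_mpoly2Y.
Qed.

(** * Leading forms of coordinates *)

Section Homogenization.
Variables (K : fieldType) (S : comNzRingType) (h : {rmorphism K -> S}) (A B : S).

(** This is B^n P(A / B), written without division. *)
Definition homogenize n (P : {poly K}) : S :=
  \sum_(j < n.+1) h P`_j * (A ^+ j * B ^+ (n - j)).

Lemma homogenize_mulXsubC n (P : {poly K}) z : (size P <= n.+1)%N ->
  homogenize n.+1 (('X - z%:P) * P) = (A - h z * B) * homogenize n P.
Proof.
move=> szP; rewrite /homogenize.
under eq_bigr do rewrite mulrBl coefB coefXM coefCM rmorphB mulrBl.
rewrite sumrB mulrBl; congr (_ - _).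
  rewrite big_ord_recl /= rmorph0 mul0r add0r mulr_sumr.
  by apply: eq_bigr => j _; rewrite /bump /= add1n /= subSS exprS; ring.
rewrite big_ord_recr /= [P`_n.+1]nth_default // mulr0 rmorph0 mul0r addr0.
rewrite mulr_sumr; apply: eq_bigr => j _.
by rewrite rmorphM subSn -1?ltnS // exprS; ring.
Qed.

Lemma homogenize_prod (s : seq K) :
  homogenize (size s) (\prod_(z <- s) ('X - z%:P)) =
  \prod_(z <- s) (A - h z * B).
Proof.
elim: s => [|z s IHs].
  by rewrite !big_nil /homogenize big_ord_recl big_ord0 coef1 rmorph1 !mulr1 addr0.
by rewrite !big_cons homogenize_mulXsubC ?IHs // size_prod_XsubC.
Qed.

Lemma homogenizeZ n c P : homogenize n (c *: P) = h c * homogenize n P.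
Proof.
rewrite /homogenize mulr_sumr; apply: eq_bigr => j _.
by rewrite coefZ rmorphM -mulrA.
Qed.

End Homogenization.

(** Applied to a leading form fixed by a deformation, this makes each of its factors constant in
    s. *)
Lemma size_factor_const (R : idomainType) (P Q : {poly R}) (c : R) :
  c != 0 -> P * Q = c%:P -> (size P <= 1)%N.
Proof.
move=> c0 PQ; have : P * Q != 0 by rewrite PQ polyC_eq0.
rewrite mulf_eq0 negb_or => /andP[P0 Q0].
have := size_mul P0 Q0; rewrite PQ size_polyC c0.
by have := size_poly_gt0 Q; rewrite Q0; lia.
Qed.

Lemma prodr_seq_const (R : pzRingType) (T : eqType) (s : seq T) (F : T -> R) v :
  {in s, forall z, F z = v} -> \prod_(z <- s) F z = v ^+ size s.
Proof.
elim: s => [|z s IHs] Fv; first by rewrite big_nil.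
rewrite big_cons Fv ?mem_head // IHs ?exprS // => z' z's.
by rewrite Fv // in_cons z's orbT.
Qed.

Lemma size_root_const (R : idomainType) (P : {poly R}) (n : nat) :
  (0 < n)%N -> (size (P ^+ n) <= 1)%N -> (size P <= 1)%N.
Proof. by have := size_exp P n; nia. Qed.

Section LeadingForm.
Variable K : fieldType.
Hypothesis splitK : forall P : {poly K},
  exists s : seq K, P = lead_coef P *: \prod_(z <- s) ('X - z%:P).
Local Notation D := {mpoly K[2]}.
Local Notation x := ('X_ord0 : D).
Local Notation y := ('X_ord_max : D).
Local Notation iota := (polyC \o @mpolyC 2 K).

(** The monomials of weight [w1 * d] are x^(d - pk) y^(qk), so the form is a power of x times a
    homogeneous form in x^p and y^q, which splits into linear factors. The arbitrary evaluation
    makes this usable both at (x, y) and at a deformation. *)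
Lemma coef_grade_factor (f : D) (w1 w2 d p q : nat) :
    (0 < w1)%N -> (0 < w2)%N -> (0 < p)%N -> (0 < q)%N ->
    coprime p q -> (w1 * p = w2 * q)%N -> f@_(mon2 d 0) != 0 ->
  exists s : seq K, size s = (d %/ p)%N /\
    forall (S : comNzRingType) (h : {rmorphism K -> S}) (a b : S),
      eval2 h a b (grade w1 w2 f)`_(w1 * d) =
      h f@_(mon2 d 0) *
        (a ^+ (d %% p) * \prod_(z <- s) (a ^+ p - h z * b ^+ q)).
Proof.
move=> w1_gt0 w2_gt0 p_gt0 q_gt0 cpq ewpq fd0.
pose k0 := (d %/ p)%N; pose c k := f@_(mon2 (d - p * k) (q * k)).
have ed : d = (p * k0 + d %% p)%N by rewrite {1}(divn_eq d p) mulnC.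
have formE : (grade w1 w2 f)`_(w1 * d) =
    \sum_(k < k0.+1) c k *: 'X_[mon2 (d - p * k) (q * k)].
  apply/mpolyP => m; rewrite mcoeff_grade raddf_sum /=.
  under eq_bigr do rewrite mcoeffZ mcoeffX.
  case: eqP => [em|nem].
    have eqm : (q * m ord0 + p * m ord_max = q * d)%N.
      apply/eqP; rewrite -(eqn_pmul2l w1_gt0) -[X in _ == X]mulnCA.
      by rewrite -em /wdeg; apply/eqP; nia.
    have /dvdnP[k ek] : (q %| m ord_max)%N.
      rewrite -(@Gauss_dvdr q p) 1?coprime_sym //.
      by rewrite -(dvdn_addr _ (dvdn_mulr (m ord0) (dvdnn q))) eqm dvdn_mulr.
    have em0 : (m ord0 = d - p * k)%N.
      suff : (m ord0 + p * k = d)%N by lia.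
      by apply/eqP; rewrite -(eqn_pmul2l q_gt0); apply/eqP; nia.
    have lek : (k < k0.+1)%N.
      rewrite ltnS /k0 leq_divRL //.
      have : (q * (p * k) <= q * d)%N by nia.
      by rewrite leq_pmul2l // mulnC.
    have emm : m = mon2 (d - p * k) (q * k).
      by rewrite [LHS]mon2E em0 ek [(k * q)%N]mulnC.
    rewrite (bigD1 (Ordinal lek)) //= -emm eqxx mulr1 big1 => [|k' ne].
      by rewrite /c -emm addr0.
    case: eqP => [e|]; last by rewrite mulr0.
    case/negP: ne; apply/eqP/val_inj => /=; apply/eqP.
    rewrite -(eqn_pmul2l q_gt0); apply/eqP.
    by rewrite [RHS]mulnC -ek -e mon2_1.
  rewrite big1 // => k _; case: eqP => [e|]; last by rewrite mulr0.
  case: nem; rewrite -e /wdeg mon2_0 mon2_1.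
  have : (p * k <= d)%N.
    by have := ltn_ord k; rewrite ltnS /k0 leq_divRL // mulnC.
  by nia.
(* The order of the coefficients is reversed, so that the nonzero coefficient of x^d becomes the
   leading one. *)
pose P : {poly K} := \poly_(j < k0.+1) c (k0 - j)%N.
have c0 : c 0%N = f@_(mon2 d 0) by rewrite /c !muln0 subn0.
have szP : size P = k0.+1.
  by apply: size_poly_eq; rewrite /= subnn c0.
have lcP : lead_coef P = f@_(mon2 d 0).
  by rewrite lead_coefE szP coef_poly ltnSn subnn c0.
have [s eP] := splitK P; rewrite lcP in eP.
have szs : size s = k0.
  by move: szP; rewrite eP size_scale // size_prod_XsubC => -[].
exists s; split=> // S h a b.
rewrite formE rmorph_sum -homogenize_prod szs mulrCA -homogenizeZ -eP.
rewrite /homogenize mulr_sumr (reindex_inj rev_ord_inj) /=.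
apply: eq_bigr => k _; rewrite eval2Z (mpolyX2E _ (mon2 _ _)) rmorphM !rmorphXn /=.
rewrite eval2X eval2Y mon2_0 mon2_1 subSS.
have lek : (k <= k0)%N by rewrite -ltnS.
rewrite coef_poly ltn_ord -!exprM [RHS]mulrCA mulrA [in RHS]mulrA.
rewrite -!mulrA; congr (_ * _); rewrite mulrA -exprD; congr (_ ^+ _ * _).
by rewrite {1}ed mulnBr; have : (p * k <= p * k0)%N; [rewrite leq_mul2l lek orbT | lia].
Qed.

(** All factors of the leading form are fixed by its deformation (U, V). A second root or a leftover
    factor x would make U or V, hence both, constant. So there is a single root l, nonzero because
    of [m1], and U^p - l V^q = x^p - l y^q; [fermat_polynomial_const] excludes that p and q both
    exceed 1. *)
Lemma leading_form_binomial (f : D) (w1 w2 d : nat) (m1 : 'X_{1..2}) :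
    has_deformation f -> (0 < w1)%N -> (0 < w2)%N ->
    (forall m, m \in msupp f -> (wdeg w1 w2 m <= w1 * d)%N) ->
    f@_(mon2 d 0) != 0 -> m1 \in msupp f -> wdeg w1 w2 m1 = (w1 * d)%N ->
    m1 != mon2 d 0 ->
  exists (p q e : nat) (l : K),
    [/\ ((0 < p)%N /\ (0 < q)%N) /\ (p = 1%N \/ q = 1%N),
        (w1 * p = w2 * q)%N, d = (p * e)%N, l != 0 &
        (grade w1 w2 f)`_(w1 * d) =
          f@_(mon2 d 0) *: (x ^+ p - l *: y ^+ q) ^+ e].
Proof.
move=> cf w1_gt0 w2_gt0 lef fd0 m1f wm1 nm1.
pose g := gcdn w1 w2; pose p := (w2 %/ g)%N; pose q := (w1 %/ g)%N.
have g_gt0 : (0 < g)%N by rewrite gcdn_gt0 w1_gt0.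
have e1 : w1 = (q * g)%N by rewrite divnK // dvdn_gcdl.
have e2 : w2 = (p * g)%N by rewrite divnK // dvdn_gcdr.
have p_gt0 : (0 < p)%N by rewrite divn_gt0 // dvdn_leq // dvdn_gcdr.
have q_gt0 : (0 < q)%N by rewrite divn_gt0 // dvdn_leq // dvdn_gcdl.
have cpq : coprime p q.
  rewrite /coprime -(eqn_pmul2r g_gt0) mul1n muln_gcdl -e1 -e2.
  by rewrite gcdnC.
have ew : (w1 * p = w2 * q)%N by rewrite e1 e2; nia.
have [U [V [U_0 V_0 LUV nUV]]] := leading_form_deformation cf w1_gt0 w2_gt0 lef.
have [s [szs factor]] := coef_grade_factor w1_gt0 w2_gt0 p_gt0 q_gt0 cpq ew fd0.
set L := (grade w1 w2 f)`_(w1 * d) in LUV factor *.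
set c := f@_(mon2 d 0) in fd0 factor *.
have LE : L = c%:MP * (x ^+ (d %% p) * \prod_(z <- s) (x ^+ p - z%:MP * y ^+ q)).
  by have := factor _ (@mpolyC 2 K) x y; rewrite eval2_id.
have LUVE : L%:P = c%:MP%:P *
    (U ^+ (d %% p) * \prod_(z <- s) (U ^+ p - z%:MP%:P * V ^+ q)).
  by have := factor _ iota U V; rewrite LUV.
have L0 : L != 0.
  apply/eqP => L0; have := mcoeff_grade w1 w2 f (w1 * d) (mon2 d 0).
  rewrite -/L L0 mcoeff0 /wdeg mon2_0 mon2_1 muln0 addn0 eqxx => /esym e.
  by move: fd0; rewrite /c e eqxx.
(* Each factor divides a nonzero constant, so it is constant in s; its value is read off at s =
   0. *)
have constF (z : K) : z \in s ->
    U ^+ p - z%:MP%:P * V ^+ q = (x ^+ p - z%:MP * y ^+ q)%:P.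
  move=> zs; move: LUVE; rewrite (big_rem z zs) /=.
  move: (\prod_(_ <- _) _) => R; move eF : (_ - _) => F LUVF.
  have szF : (size F <= 1)%N.
    apply: (@size_factor_const _ F (c%:MP%:P * (U ^+ (d %% p) * R)) L L0).
    by rewrite LUVF mulrCA; congr (_ * _); rewrite mulrCA.
  rewrite (size1_polyC szF); congr _%:P.
  by rewrite -eF coefB coefCM -!horner_coef0 !horner_exp !horner_coef0 U_0 V_0.
(* For a nonzero root, [constF] expresses a power of U through V and conversely, so if one is
   constant, so is the other. *)
have UV_const : (size U <= 1)%N \/ (size V <= 1)%N ->
    forall z, z != 0 -> z \in s -> False.
  move=> UV z z0 zs; apply: nUV; have := constF z zs.
  move: (_ - z%:MP * _) => C eC.
  case: UV => sz; split=> //.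
    apply: (size_root_const q_gt0).
    have e : z%:MP%:P * V ^+ q = U ^+ p - C%:P by rewrite -eC opprB addrCA subrr addr0.
    move: e; rewrite (size1_polyC sz) -rmorphXn -polyCB => e.
    rewrite -(@size_scale _ z%:MP) ?mpolyC_eq0 // -mul_polyC e; exact: size_polyC_leq1.
  apply: (size_root_const p_gt0).
  have -> : U ^+ p = C%:P + z%:MP%:P * V ^+ q by rewrite -eC subrK.
  rewrite (size1_polyC sz) -rmorphXn -polyCM -polyCD; exact: size_polyC_leq1.
(* If all roots were 0, L would be a multiple of x^d and [m1] could not occur in it. *)
have [l ls l0] : exists2 l, l \in s & l != 0.
  apply/hasP; apply: contraNT nm1; rewrite -all_predC => /allP s0.
  have : L@_m1 != 0 by rewrite mcoeff_grade wm1 eqxx -mcoeff_msupp.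
  have -> : L = c *: 'X_[mon2 d 0].
    rewrite LE mul_mpolyC; congr (_ *: _).
    rewrite (prodr_seq_const (v := x ^+ p)) => [|z /s0 /negbNE /eqP ->].
      rewrite szs -exprM -exprD.
      by rewrite (mpolyX2E _ (mon2 _ _)) mon2_0 mon2_1 expr0 mulr1 addnC mulnC -divn_eq.
    by rewrite mpolyC0 mul0r subr0.
  case: (m1 =P mon2 d 0) => // /eqP/negPf ne.
  by rewrite mcoeffZ mcoeffX [_ == m1]eq_sym ne mulr0 eqxx.
(* The difference of the invariants belonging to two roots is (z - l) V^q, which would make V
   constant. *)
have sl z : z \in s -> z = l.
  move=> zs; apply/eqP; apply/negPn/negP => zl; apply: (UV_const _ l l0 ls); right.
  apply: (size_root_const q_gt0).
  have e : (z - l)%:MP%:P * V ^+ q = ((z - l)%:MP * y ^+ q)%:P.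
    transitivity ((U ^+ p - l%:MP%:P * V ^+ q) - (U ^+ p - z%:MP%:P * V ^+ q)).
      by rewrite mpolyCB polyCB; ring.
    transitivity ((x ^+ p - l%:MP * y ^+ q)%:P - (x ^+ p - z%:MP * y ^+ q)%:P).
      by congr (_ - _); apply: constF.
    by rewrite -polyCB mpolyCB; congr _%:P; ring.
  rewrite -(@size_scale _ (z - l)%:MP) ?mpolyC_eq0 ?subr_eq0 // -mul_polyC.
  by rewrite e; exact: size_polyC_leq1.
have dp0 : (d %% p = 0)%N.
  apply/eqP; rewrite -leqn0 leqNgt; apply/negP => dp_gt0.
  apply: (UV_const _ l l0 ls); left; apply: (size_root_const dp_gt0).
  by move: LUVE => /esym; rewrite mulrCA => /(size_factor_const L0).
exists p, q, (d %/ p)%N, l; split=> //; first split=> //.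
- have [->|p1] := eqVneq p 1%N; first by left.
  have [->|q1] := eqVneq q 1%N; first by right.
  case: nUV.
  have dX (i j : 'I_2) : mderiv i ('X_j : D) = (i == j)%:R.
    rewrite mderivX mnm1E eq_sym; case: eqP => [->|_]; last by rewrite scale0r.
    have -> : (U_(j) - U_(j) = 0)%MM by apply/mnmP => k; rewrite mnmBE subnn mnm0E.
    by rewrite mpolyX0 scale1r.
  have X0 i : 'X_i != 0 :> D by rewrite -msize_poly_eq0 msizeX.
  apply: (@fermat_polynomial_const D (mderiv ord0) (mderiv ord_max) x y
     l%:MP l^-1%:MP U V p q (mderivM _) (mderivM _)); try by [].
  - by rewrite [LHS]dX.
  - by rewrite [LHS]dX.
  - by rewrite [LHS]dX.
  - by rewrite [LHS]dX.
  - exact: mderivC.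
  - exact: mderivC.
  - by rewrite -mpolyCM divff // mpolyC1.
  - by rewrite ltn_neqAle eq_sym p1.
  - by rewrite ltn_neqAle eq_sym q1.
  by rewrite -mul_polyC; apply: constF.
- by rewrite mulnC; have := divn_eq d p; rewrite dp0 addn0.
- rewrite LE mul_mpolyC dp0 expr0 mul1r -/c; congr (_ *: _).
  rewrite (prodr_seq_const (v := x ^+ p - l *: y ^+ q)) ?szs // => z /sl ->.
  by rewrite mul_mpolyC.
Qed.
End LeadingForm.

(** * Reduction to coordinates of lower degree *)

(** The quotient a / b is minimized by cross multiplication; this selects the edge of a Newton
    polygon that starts at a power of x. *)
Lemma seq_min_fraction (T : eqType) (a b : T -> nat) (s : seq T) (t1 : T) :
  t1 \in s -> {in s, forall t, 0 < b t}%N ->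
  exists2 t0, t0 \in s & {in s, forall t, a t0 * b t <= a t * b t0}%N.
Proof.
elim: s t1 => // t s IHs t1 _ b_gt0.
case: s IHs b_gt0 => [|t2 s] IHs b_gt0.
  by exists t; rewrite ?mem_head // => t' /[!inE] /eqP ->.
have [|t' t's|t0 t0s min0] := IHs t2; first exact: mem_head.
  by apply: b_gt0; rewrite in_cons t's orbT.
have bt := b_gt0 t (mem_head _ _).
have bt0 : (0 < b t0)%N by apply: b_gt0; rewrite in_cons t0s orbT.
have [le|lt] := leqP (a t0 * b t) (a t * b t0).
  exists t0; first by rewrite in_cons t0s orbT.
  by move=> t' /[!in_cons] /orP[/eqP -> // | /min0].
exists t; first exact: mem_head.
move=> t' /[!in_cons] /orP[/eqP -> // | t's].
have bt' : (0 < b t')%N by apply: b_gt0; rewrite !in_cons t's orbT.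
have := min0 _ t's; rewrite -(leq_pmul2r bt) => le'.
rewrite -(leq_pmul2r bt0); nia.
Qed.

Section Descent.
Variable K : fieldType.
Hypothesis splitK : forall P : {poly K},
  exists s : seq K, P = lead_coef P *: \prod_(z <- s) ('X - z%:P).
Local Notation D := {mpoly K[2]}.
Local Notation x := ('X_ord0 : D).
Local Notation y := ('X_ord_max : D).

Lemma mcoeff_x_exp c n m : (c *: x ^+ n : D)@_m = if m == mon2 n 0 then c else 0.
Proof.
rewrite mcoeffZ.
have -> : x ^+ n = 'X_[mon2 n 0].
  by rewrite (mpolyX2E _ (mon2 _ _)) mon2_0 mon2_1 expr0 mulr1.
by rewrite mcoeffX eq_sym; case: eqP; rewrite ?mulr1 ?mulr0.
Qed.

(** The shear x -> x + l y^k respects the weights (k, 1), so it commutes with taking the leading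
    form and turns that form into c x^d. *)
Lemma shift_leading_form (f : D) (k d : nat) (c l : K) : (0 < k)%N ->
    (forall m, m \in msupp f -> (wdeg k 1 m <= k * d)%N) ->
    (grade k 1 f)`_(k * d) = c *: (x - l *: y ^+ k) ^+ d ->
    let f' := f \mPo [tuple x + l *: y ^+ k; y] in
  [/\ f'@_(mon2 d 0) = c,
      forall m, m \in msupp f' -> (wdeg k 1 m <= k * d)%N &
      forall m, m \in msupp f' -> m != mon2 d 0 -> (wdeg k 1 m < k * d)%N].
Proof.
move=> k_gt0 lef lead f'.
pose a := x + l *: y ^+ k.
have ga : grade k 1 a = a%:P * 'X^k.
  rewrite /grade rmorphD /= eval2Z rmorphXn /= eval2X eval2Y.
  rewrite exprMn -exprM mul1n mulrA -mulrDl; congr (_ * _).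
  by rewrite /a polyCD -mul_mpolyC polyCM rmorphXn.
have gf' : grade k 1 f' =
    \sum_(m <- msupp f) (f@_m *: (a ^+ m ord0 * y ^+ m ord_max))%:P * 'X^(wdeg k 1 m).
  rewrite /f' comp_mpoly2E /grade rmorph_eval2 -/(grade k 1).
  have -> := @eq_eval2 _ _ _ (polyC \o @mpolyC 2 K) (grade k 1 a) (grade k 1 y) f.
    rewrite eval2E ga; apply: eq_bigr => m _.
    rewrite -mul_mpolyC polyCM /= -mulrA; congr (_ * _).
    rewrite /grade eval2Y expr1 /wdeg mul1n exprD exprM !exprMn polyCM !rmorphXn /=.
    by rewrite mulrACA.
  by move=> t; rewrite /= /grade eval2C.
have lead' : (grade k 1 f')`_(k * d) = c *: x ^+ d.
  transitivity (eval2 (@mpolyC 2 K) a y (grade k 1 f)`_(k * d)).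
    rewrite gf' coef_sum eval2_coef_grade [RHS]big_mkcond; apply: eq_bigr => m _.
    rewrite coefCM coefXn eq_sym -mul_mpolyC.
    by case: eqP; rewrite ?mulr1 ?mulr0.
  rewrite lead eval2Z rmorphXn rmorphB /= eval2Z rmorphXn /= eval2X eval2Y.
  by rewrite mul_mpolyC /a mul_mpolyC addrK.
have le' m : m \in msupp f' -> (wdeg k 1 m <= k * d)%N.
  move: m; apply/size_gradeP; rewrite gf'; apply/leq_sizeP => j lt.
  rewrite coef_sum big_seq big1 // => m mf; rewrite coefCM coefXn.
  by rewrite gtn_eqF ?mulr0 // (leq_ltn_trans (lef _ mf)).
have coef' m : wdeg k 1 m = (k * d)%N -> f'@_m = if m == mon2 d 0 then c else 0.
  by move=> em; rewrite -mcoeff_x_exp -lead' mcoeff_grade em eqxx.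
split=> //.
  by rewrite coef' ?eqxx // /wdeg mon2_0 mon2_1 muln0 addn0.
move=> m mf' nm; rewrite ltn_neqAle le' // andbT; apply/eqP => em.
by move: mf'; rewrite mcoeff_msupp coef' // (negPf nm) eqxx.
Qed.

Lemma shear_inverse k (l : K) :
  inverse_pairs (x + l *: y ^+ k) y (x - l *: y ^+ k) y.
Proof.
by apply: inverse_shear => a; rewrite comp_mpolyZ rmorphXn /= comp_mpoly2Y.
Qed.

(* The slope of the Newton polygon drops by at least one, since non-integral
   slopes above 1 are excluded by [leading_form_binomial]. *)
Lemma descent_step (f : D) (k e : nat) : (1 < k)%N -> coord f ->
    f@_(mon2 e 0) != 0 ->
    (forall m, m \in msupp f -> (wdeg k 1 m <= k * e)%N) ->
  exists l : K, let f' := f \mPo [tuple x + l *: y ^+ k; y] in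
    [/\ coord f', f'@_(mon2 e 0) != 0 &
        forall m, m \in msupp f' -> (wdeg k.-1 1 m <= k.-1 * e)%N].
Proof.
move=> k1 cf fe lef; have k_gt0 := ltnW k1.
(* With weights (k, 1) one has q = k p, and k > 1 leaves only p = 1. If x^e is alone in its weight,
   l = 0 works. *)
have [l leadl] : exists l : K,
    (grade k 1 f)`_(k * e) = f@_(mon2 e 0) *: (x - l *: y ^+ k) ^+ e.
  have [/hasP[m1 m1f /andP[/eqP wm1 nm1]]|none] :=
      boolP (has (fun m => (wdeg k 1 m == k * e)%N && (m != mon2 e 0)) (msupp f)).
    have [p [q [d [l [[[p0 q0] pq] epq -> _ ->]]]]] :=
      leading_form_binomial splitK (coord_deformation cf) k_gt0 (ltn0Sn 0) lef fe m1f wm1 nm1.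
    have [ep eq] : p = 1%N /\ q = k by nia.
    by exists l; rewrite ep eq mul1n.
  exists 0; rewrite scale0r subr0; apply/mpolyP => m.
  rewrite mcoeff_grade mcoeff_x_exp; case: eqP => [em|nem]; last first.
    by case: eqP nem => // ->; rewrite /wdeg mon2_0 mon2_1 muln0 addn0.
  case: eqP => [-> //|/eqP nm]; apply/memN_msupp_eq0; apply: contra none => mf.
  by apply/hasP; exists m; rewrite // em eqxx.
have [f'e le' lt'] := shift_leading_form k_gt0 lef leadl.
exists l => f'; have cf' : coord f' by apply: coord_comp cf; apply: shear_inverse.
split=> //; first by rewrite f'e.
have f'e0 : f'@_(mon2 e 0) != 0 by rewrite f'e.
(* A monomial violating the bound lies above the line of slope k - 1 through x^e and, after the
   shear, strictly below the one of slope k. *)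
move=> m mf'; rewrite leqNgt; apply/negP => gtm.
have nm : m != mon2 e 0.
  by apply: contraTneq gtm => ->; rewrite /wdeg mon2_0 mon2_1 muln0 addn0 ltnn.
pose s := [seq m <- msupp f' | m != mon2 e 0].
have small m' : m' \in s -> (m' ord0 < e)%N /\ (wdeg k 1 m' < k * e)%N.
  rewrite mem_filter => /andP[nm' m'f]; have lt := lt' _ m'f nm'.
  by split=> //; rewrite -(ltn_pmul2l k_gt0); move: lt; rewrite /wdeg; lia.
(* [m0] spans the steepest edge at x^e: the gain in the y-exponent per loss in the x-exponent is
   maximal. *)
have [||m0 m0s max0] := @seq_min_fraction _ (fun m : 'X_{1..2} => e - m ord0)%N
    (fun m : 'X_{1..2} => m ord_max) (filter (fun m : 'X_{1..2} => (0 < m ord_max)%N) s) m.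
- rewrite !mem_filter nm mf' !andbT lt0n; apply: contraTneq gtm => e0.
  rewrite /wdeg e0 muln0 addn0 -leqNgt leq_mul2l.
  by have [] := small m; rewrite ?mem_filter ?nm // => /ltnW ->; rewrite orbT.
- by move=> m'; rewrite mem_filter => /andP[].
move: m0s; rewrite mem_filter => /andP[m0_gt0 m0s].
have [m0e wm0] := small _ m0s.
have [me wm] : (m ord0 < e)%N /\ (wdeg k 1 m < k * e)%N.
  by apply: small; rewrite mem_filter nm.
have m_gt0 : (0 < m ord_max)%N.
  by move: gtm me; rewrite /wdeg; nia.
have maxm : ((e - m0 ord0) * m ord_max <= (e - m ord0) * m0 ord_max)%N.
  by apply: max0; rewrite !mem_filter m_gt0 nm.
have em0_gt0 : (0 < e - m0 ord0)%N by lia.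
have lef0 m' : m' \in msupp f' ->
    (wdeg (m0 ord_max) (e - m0 ord0) m' <= m0 ord_max * e)%N.
  move=> m'f; have [->|nm'] := eqVneq m' (mon2 e 0).
    by rewrite /wdeg mon2_0 mon2_1 muln0 addn0.
  have [m'e _] : (m' ord0 < e)%N /\ (wdeg k 1 m' < k * e)%N.
    by apply: small; rewrite mem_filter nm'.
  have : ((e - m0 ord0) * m' ord_max <= (e - m' ord0) * m0 ord_max)%N.
    have [->|m'0] := posnP (m' ord_max); first by rewrite muln0.
    by apply: max0; rewrite !mem_filter m'0 nm'.
  rewrite /wdeg; have := ltnW m'e; clear; nia.
have m0f : m0 \in msupp f' by move: m0s; rewrite mem_filter => /andP[].
have nm0 : m0 != mon2 e 0 by move: m0s; rewrite mem_filter => /andP[].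
have wm0e : wdeg (m0 ord_max) (e - m0 ord0) m0 = (m0 ord_max * e)%N.
  by rewrite /wdeg; move: (ltnW m0e); clear; nia.
(* The slope of this edge is q / p and lies strictly between k - 1 and k. But p = 1 makes it an
   integer, and q = 1 makes it at most 1. *)
have [p [q [d [l' [[[p0 q0] pq] epq _ _ _]]]]] :=
  leading_form_binomial splitK (coord_deformation cf') m0_gt0 em0_gt0 lef0 f'e0 m0f
    wm0e nm0.
move: gtm wm0 maxm epq pq p0 q0 k1 me m0e; rewrite /wdeg !mul1n; clear.
move: (m ord0) (m ord_max) (m0 ord0) (m0 ord_max) => a b a0 b0.
move=> gt lt max epq pq p0 q0 k1 ae a0e.
have lt1 : ((k.-1) * (e - a0) < b0)%N.
  have : (k.-1 * (e - a) < b)%N by rewrite mulnBr; lia.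
  nia.
have lt2 : (b0 < k * (e - a0))%N by rewrite mulnBr; lia.
case: pq => ?; subst.
  have : (k.-1 < q)%N by nia.
  have : (q < k)%N by nia.
  lia.
nia.
Qed.

(** Shears lower k step by step to 1, where the weight is the total degree and the remaining
    coordinate has degree e. Undoing the shears contributes one term in y^j for each j from 2 to
    k. *)
Lemma descent (k : nat) (f : D) (e : nat) : coord f -> (0 < k)%N ->
    f@_(mon2 e 0) != 0 ->
    (forall m, m \in msupp f -> (wdeg k 1 m <= k * e)%N) ->
  exists (q : nat -> K) (f1 : D),
    [/\ coord f1, msize f1 = e.+1 &
        f = f1 \mPo [tuple x + \sum_(2 <= j < k.+1) q j *: y ^+ j; y]].
Proof.
elim: k f => // k IHk f cf _ fe lef.
have [k0|k_gt0] := posnP k.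
  exists (fun=> 0), f; split=> //.
    apply/eqP; rewrite eqn_leq; apply/andP; split; last first.
      have := @msize_mdeg_lt _ _ f (mon2 e 0).
      by rewrite mcoeff_msupp fe mdeg2E mon2_0 mon2_1 addn0; apply.
    rewrite msizeE; apply/bigmax_leqP_seq => m mf _; have := lef m mf.
    by rewrite k0 /wdeg !mul1n ltnS mdeg2E.
  by rewrite k0 big_geq // addr0 comp_mpoly2_id.
have [l [cf' f'e lef']] := descent_step (k := k.+1) k_gt0 cf fe lef.
have [q [f1 [cf1 sz1 ef']]] := IHk _ cf' k_gt0 f'e lef'.
pose Q := \sum_(2 <= j < k.+1) q j *: y ^+ j.
have eQ : \sum_(2 <= j < k.+2) (if j == k.+1 then - l else q j) *: y ^+ j =
          Q - l *: y ^+ k.+1.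
  rewrite big_nat_recr //= eqxx scaleNr; congr (_ - _).
  by apply: eq_big_nat => j /andP[_ lt]; rewrite (ltn_eqF lt).
exists (fun j => if j == k.+1 then - l else q j), f1; rewrite eQ; split=> //.
transitivity (f \mPo [tuple x + l *: y ^+ k.+1; y] \mPo [tuple x - l *: y ^+ k.+1; y]).
  have [ex _ _ _] := shear_inverse k.+1 (- l).
  move: ex; rewrite scaleNr opprK => ex.
  by rewrite comp_mpoly2A ex comp_mpoly2Y comp_mpoly2_id.
rewrite ef' -/Q comp_mpoly2A comp_mpoly2Y.
suff -> : (x + Q) \mPo [tuple x - l *: y ^+ k.+1; y] = x + (Q - l *: y ^+ k.+1) by [].
rewrite comp_mpolyD comp_mpoly2X [Q - _]addrC addrA; congr (_ + _).
rewrite rmorph_sum; apply: eq_big_nat => j _ /=.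
by rewrite comp_mpolyZ rmorphXn /= comp_mpoly2Y.
Qed.

End Descent.

(** * Factoring a coordinate through one of smaller degree *)

Section CoordinateReduction.
Variable K : fieldType.
Hypothesis splitK : forall P : {poly K},
  exists s : seq K, P = lead_coef P *: \prod_(z <- s) ('X - z%:P).
Local Notation D := {mpoly K[2]}.
Local Notation x := ('X_ord0 : D).
Local Notation y := ('X_ord_max : D).
Local Notation iota := (polyC \o @mpolyC 2 K).

Lemma mcoeff_swap (f : D) m :
  (f \mPo [tuple y; x])@_m = f@_(mon2 (m ord_max) (m ord0)).
Proof.
rewrite [in RHS](mpolyE f) comp_mpolyEX !raddf_sum /=; apply: eq_bigr => m' _.
rewrite !mcoeffZ (mpolyX2E _ m') rmorphM !rmorphXn /= comp_mpoly2X comp_mpoly2Y.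
have -> : y ^+ m' ord0 * x ^+ m' ord_max = 'X_[mon2 (m' ord_max) (m' ord0)].
  by rewrite (mpolyX2E _ (mon2 _ _)) mon2_0 mon2_1 mulrC.
rewrite -(mpolyX2E _ m') !mcoeffX; congr (_ * (nat_of_bool _)%:R).
apply/eqP/eqP => [<-|->]; last by rewrite mon2_0 mon2_1 -mon2E.
by rewrite mon2_0 mon2_1 -mon2E.
Qed.

Lemma msize_swap (f : D) : msize (f \mPo [tuple y; x]) = msize f.
Proof.
have le (g : D) : (msize (g \mPo [tuple y; x]) <= msize g)%N.
  rewrite [leqLHS]msizeE; apply/bigmax_leqP_seq => m; rewrite mcoeff_msupp mcoeff_swap.
  rewrite -mcoeff_msupp => /msize_mdeg_lt + _.
  by rewrite !mdeg2E mon2_0 mon2_1 addnC.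
apply/eqP; rewrite eqn_leq le /=; have := le (f \mPo [tuple y; x]).
by rewrite comp_mpoly2A comp_mpoly2X comp_mpoly2Y comp_mpoly2_id.
Qed.

Lemma mcoeff_restrict_y (f : D) e :
  (f \mPo [tuple 0; y])@_(mon2 0 e) = f@_(mon2 0 e).
Proof.
rewrite [in RHS](mpolyE f) comp_mpolyEX !raddf_sum /=; apply: eq_bigr => m _.
rewrite !mcoeffZ; congr (_ * _).
rewrite [in LHS](mpolyX2E _ m) rmorphM !rmorphXn /= comp_mpoly2X comp_mpoly2Y expr0n.
rewrite mcoeffX; have [m0|m0] := eqVneq (m ord0) 0%N.
  rewrite mul1r {2}[m]mon2E m0.
  have -> : y ^+ m ord_max = 'X_[mon2 0 (m ord_max)].
    by rewrite (mpolyX2E _ (mon2 _ _)) mon2_0 mon2_1 expr0 mul1r.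
  by rewrite mcoeffX.
by rewrite mul0r mcoeff0; case: (m =P mon2 0 e) m0 => // ->; rewrite mon2_0.
Qed.

Lemma msize_prod_ge (s : seq K) (X : D) : (1 < msize X)%N ->
  (size s < msize (\prod_(z <- s) (X - z%:MP)))%N.
Proof.
move=> X2; elim: s => [|z s IHs]; first by rewrite big_nil msize1.
have szXz : (1 < msize (X - z%:MP))%N.
  rewrite ltnNge; apply/negP => le; have := msizeD_le (X - z%:MP) z%:MP.
  rewrite subrK msizeC; have : ((z != 0%R) <= 1)%N by case: eqP.
  by move: le X2; lia.
rewrite big_cons msizeM.
- by rewrite ltn_predRL; exact: leq_add szXz IHs.
- by rewrite -msize_poly_eq0 -lt0n ltnW.
by rewrite -msize_poly_eq0 -lt0n (leq_ltn_trans _ IHs).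
Qed.

(** If f = P(x), then x = f(X, Y) = P(X) is a scalar times n factors X - z. For nonconstant X this
    product has degree at least n, and for constant X it cannot be x. *)
Lemma coord_univariate (f : D) n : coord f ->
    (forall m, m \in msupp f -> m ord_max = 0%N /\ (m ord0 <= n)%N) ->
  f@_(mon2 n 0) != 0 -> (n <= 1)%N.
Proof.
move=> [g [X [Y [_ _ fXY _]]]] univ fn.
pose P := \poly_(i < n.+1) f@_(mon2 i 0).
have szP : size P = n.+1 by apply: size_poly_eq.
have [s eP] := splitK P.
have lc0 : lead_coef P != 0 by rewrite lead_coef_eq0 -size_poly_gt0 szP.
have szs : size s = n.
  by move: szP; rewrite eP size_scale // size_prod_XsubC => -[].
have eX : x = (lead_coef P)%:MP * \prod_(z <- s) (X - z%:MP).
  transitivity (homogenize (@mpolyC 2 K) X 1 n P).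
    have ef : f = \sum_(j < n.+1) f@_(mon2 j 0) *: x ^+ j.
      apply/mpolyP => m; rewrite raddf_sum /=.
      under eq_bigr do rewrite mcoeff_x_exp.
      have [m1|m1] := eqVneq (m ord_max) 0%N; last first.
        rewrite big1 => [|j _]; last first.
          by case: (m =P mon2 j 0) m1 => // ->; rewrite mon2_1.
        by apply/memN_msupp_eq0; apply: contraNN m1 => /univ[-> _].
      have [lt|gt] := ltnP (m ord0) n.+1.
        have em : m = mon2 (m ord0) 0 by rewrite {1}[m]mon2E m1.
        rewrite (bigD1 (Ordinal lt)) //= -em eqxx big1 ?addr0 // => j ne.
        case: (m =P mon2 j 0) => // emj; case/negP: ne; apply/eqP/val_inj.
        by rewrite /= emj mon2_0.
      rewrite big1 => [|j _]; last first.
        by case: (m =P mon2 j 0) gt => // ->; rewrite mon2_0 leqNgt ltn_ord.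
      by apply/memN_msupp_eq0/negP => /univ[_]; rewrite leqNgt gt.
    rewrite -fXY {1}ef comp_mpoly2E rmorph_sum /homogenize; apply: eq_bigr => j _.
    rewrite /= eval2Z rmorphXn /= eval2X expr1n mulr1.
    by rewrite coef_poly ltn_ord.
  rewrite {1}eP homogenizeZ -szs homogenize_prod; congr (_ * _).
  by apply: eq_bigr => z _; rewrite mulr1.
have [X2|] := ltnP 1 (msize X).
  have := msize_prod_ge s X2; rewrite szs.
  have := msizeX K (U_(ord0 : 'I_2))%MM; rewrite mdeg1 eX mul_mpolyC msizeZ // => ->.
  by rewrite ltnS.
move=> /msize1_polyC eXc; move: eX; rewrite eXc => eX.
have : (msize x <= 1)%N.
  rewrite eX.
  have -> : \prod_(z <- s) ((X@_0)%:MP_[2] - z%:MP) = (\prod_(z <- s) (X@_0 - z))%:MP.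
    by rewrite rmorph_prod; apply: eq_bigr => z _; rewrite /= mpolyCB.
  by rewrite -mpolyCM msizeC; case: eqP.
by rewrite msizeX mdeg1.
Qed.

(** Otherwise xy divides the top form, and its factors x and y are both fixed by the deformation,
    which would then be constant. *)
Lemma coord_pure_power (f : D) n : coord f -> msize f = n.+1 -> (0 < n)%N ->
  f@_(mon2 n 0) != 0 \/ f@_(mon2 0 n) != 0.
Proof.
move=> cf szf n_gt0.
have [fn|fn] := eqVneq (f@_(mon2 n 0)) 0; last by left.
have [fn'|fn'] := eqVneq (f@_(mon2 0 n)) 0; last by right.
exfalso.
have lef m : m \in msupp f -> (wdeg 1 1 m <= n)%N.
  by move=> /msize_mdeg_lt; rewrite szf ltnS mdeg2E /wdeg !mul1n.
have [U [V [_ _ LUV nUV]]] :=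
  leading_form_deformation (coord_deformation cf) (ltn0Sn 0) (ltn0Sn 0) lef.
set L := (grade 1 1 f)`_n in LUV.
have L0 : L != 0.
  have f0 : f != 0 by rewrite -msize_poly_eq0 szf.
  have := mlead_deg f0; rewrite szf => -[em].
  have := mcoeff_grade 1 1 f n (mlead f).
  rewrite /wdeg !mul1n -mdeg2E em eqxx -/L => eL.
  apply: contraTneq (mlead_supp f0) => eL0; rewrite mcoeff_msupp negbK -eL eL0.
  by rewrite mcoeff0.
pose Q := \sum_(m <- msupp L) L@_m *: 'X_[m - U_(ord0) - U_(ord_max)] : D.
have eL : L = x * (y * Q).
  rewrite {1}(mpolyE L) /Q !mulr_sumr big_seq [RHS]big_seq; apply: eq_bigr => m mL.
  rewrite -!scalerAr -!mpolyXD; congr (_ *: 'X_[_]).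
  move: mL; rewrite mcoeff_msupp mcoeff_grade /wdeg !mul1n.
  case: ifP => [/eqP em fm|_]; last by rewrite eqxx.
  have m0 : (0 < m ord0)%N.
    rewrite lt0n; apply: contraNneq fm => m0.
    by rewrite [m]mon2E m0; move: em; rewrite m0 add0n => ->; rewrite fn'.
  have m1 : (0 < m ord_max)%N.
    rewrite lt0n; apply: contraNneq fm => m1.
    by rewrite [m]mon2E m1; move: em; rewrite m1 addn0 => ->; rewrite fn.
  by apply: mon2_inj; rewrite !mnmDE !mnmBE !mnm1E /=; lia.
apply: nUV; move: LUV; rewrite {1}eL !rmorphM /= eval2X eval2Y => LUV.
split; first exact: size_factor_const L0 LUV.
by apply: (@size_factor_const _ V (U * eval2 iota U V Q) L L0); rewrite mulrCA.
Qed.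

(** For weights (1, 1) one has p = q = 1: the top form is a power of a linear form, and a shear
    turns this form into x. *)
Lemma normalize_top_form (f : D) n : coord f -> msize f = n.+1 -> (0 < n)%N ->
    f@_(mon2 n 0) != 0 ->
  exists l : K, let F := f \mPo [tuple x + l *: y; y] in
    [/\ coord F, F@_(mon2 n 0) != 0 &
        forall m, m \in msupp F -> m != mon2 n 0 -> (mdeg m < n)%N].
Proof.
move=> cf szf n_gt0 fn.
have lef m : m \in msupp f -> (wdeg 1 1 m <= 1 * n)%N.
  by move=> /msize_mdeg_lt; rewrite szf ltnS mdeg2E /wdeg !mul1n.
have [l leadl] : exists l : K,
    (grade 1 1 f)`_(1 * n) = f@_(mon2 n 0) *: (x - l *: y ^+ 1) ^+ n.
  have [/hasP[m1 m1f /andP[/eqP wm1 nm1]]|none] :=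
      boolP (has (fun m => (wdeg 1 1 m == 1 * n)%N && (m != mon2 n 0)) (msupp f)).
    have [p [q [d [l [[[p0 q0] pq] epq -> _ ->]]]]] :=
      leading_form_binomial splitK (coord_deformation cf) (ltn0Sn 0) (ltn0Sn 0) lef fn
        m1f wm1 nm1.
    have [ep eq] : p = 1%N /\ q = 1%N by lia.
    by exists l; rewrite ep eq mul1n.
  exists 0; rewrite scale0r subr0; apply/mpolyP => m.
  rewrite mcoeff_grade mcoeff_x_exp; case: eqP => [em|nem]; last first.
    by case: eqP nem => // ->; rewrite /wdeg mon2_0 mon2_1 muln0 addn0.
  case: eqP => [-> //|/eqP nm]; apply/memN_msupp_eq0; apply: contra none => mf.
  by apply/hasP; exists m; rewrite // em eqxx.
have [Fn _ ltF] := shift_leading_form (ltn0Sn 0) lef leadl.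
exists l => F; rewrite -[y in l *: y]expr1 in F *; split.
- by apply: coord_comp cf; apply: shear_inverse.
- by rewrite Fn.
by move=> m mF nm; have := ltF m mF nm; rewrite /wdeg !mul1n mdeg2E.
Qed.

(** Since x^n is the only monomial of degree n, the edge at x^n has p > q, hence q = 1. Its form is
    a multiple of (x^p - l y)^e, so y^e occurs, and exchanging the variables leads to the weights
    (p, 1). *)
Lemma extremal_edge (F : D) n : coord F -> (1 < n)%N -> F@_(mon2 n 0) != 0 ->
    (forall m, m \in msupp F -> m != mon2 n 0 -> (mdeg m < n)%N) ->
  exists k e : nat, let F1 := F \mPo [tuple y; x] in
    [/\ (1 < k)%N, n = (k * e)%N, coord F1, F1@_(mon2 e 0) != 0 &
        forall m, m \in msupp F1 -> (wdeg k 1 m <= k * e)%N].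
Proof.
move=> cF n1 Fn ltF.
have small m : m \in msupp F -> (m ord0 <= n)%N.
  move=> mF; have [->|nm] := eqVneq m (mon2 n 0); first by rewrite mon2_0.
  by have := ltF m mF nm; rewrite mdeg2E; lia.
have [m1 m1F m1_gt0] : exists2 m1, m1 \in msupp F & (0 < m1 ord_max)%N.
  apply/hasP; apply: contraLR n1; rewrite -all_predC -leqNgt => /allP noy.
  apply: (coord_univariate cF _ Fn) => m mF; split; last exact: small.
  by have := noy m mF; rewrite /= -eqn0Ngt => /eqP.
have [||m0 m0s min0] := @seq_min_fraction _ (fun m : 'X_{1..2} => n - m ord0)%N
    (fun m : 'X_{1..2} => m ord_max)
    (filter (fun m : 'X_{1..2} => (0 < m ord_max)%N) (msupp F)) m1.
- by rewrite mem_filter m1_gt0.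
- by move=> m; rewrite mem_filter => /andP[].
move: m0s; rewrite mem_filter => /andP[m0_gt0 m0F].
have nm0 : m0 != mon2 n 0.
  by apply: contraTneq m0_gt0 => ->; rewrite mon2_1.
have lt0 : (m0 ord_max < n - m0 ord0)%N.
  by have := ltF _ m0F nm0; rewrite mdeg2E; lia.
have nm0_gt0 : (0 < n - m0 ord0)%N by lia.
have leF m : m \in msupp F ->
    (wdeg (m0 ord_max) (n - m0 ord0) m <= m0 ord_max * n)%N.
  move=> mF; have lem := small m mF.
  have : ((n - m0 ord0) * m ord_max <= (n - m ord0) * m0 ord_max)%N.
    have [->|m_gt0] := posnP (m ord_max); first by rewrite muln0.
    by apply: min0; rewrite mem_filter m_gt0.
  by rewrite /wdeg; move: lem; clear; nia.
have wm0 : wdeg (m0 ord_max) (n - m0 ord0) m0 = (m0 ord_max * n)%N.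
  by rewrite /wdeg; have := small _ m0F; clear; nia.
have [p [q [e [l [[[p0 q0] pq] epq en l0 lead]]]]] :=
  leading_form_binomial splitK (coord_deformation cF) m0_gt0 nm0_gt0 leF Fn m0F wm0 nm0.
have [p1 eq1] : (1 < p)%N /\ q = 1%N by nia.
rewrite eq1 muln1 in epq; rewrite eq1 expr1 in lead.
exists p, e => F1; split=> //.
- exact: coord_comp (inverse_swap _) cF.
(* Setting x = 0 in the form isolates the coefficient of y^e, which is (-l)^e up to a nonzero
   scalar. *)
- rewrite /F1 mcoeff_swap mon2_0 mon2_1.
  have := mcoeff_grade (m0 ord_max) (n - m0 ord0) F (m0 ord_max * n) (mon2 0 e).
  have -> : wdeg (m0 ord_max) (n - m0 ord0) (mon2 0 e) = (m0 ord_max * n)%N.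
    by rewrite /wdeg mon2_0 mon2_1 muln0 add0n -epq [in RHS]en mulnA.
  rewrite eqxx lead => <-.
  rewrite mcoeffZ mulf_neq0 // -mcoeff_restrict_y.
  rewrite rmorphXn /= comp_mpolyB rmorphXn /= comp_mpolyZ comp_mpoly2X comp_mpoly2Y.
  rewrite expr0n gtn_eqF ?(ltnW p1) // sub0r -scaleNr exprZn mcoeffZ mulf_neq0 //.
    by rewrite expf_neq0 // oppr_eq0.
  have -> : y ^+ e = 'X_[mon2 0 e].
    by rewrite (mpolyX2E _ (mon2 _ _)) mon2_0 mon2_1 expr0 mul1r.
  by rewrite mcoeffX eqxx oner_neq0.
move=> m; rewrite mcoeff_msupp /F1 mcoeff_swap -mcoeff_msupp => /leF.
rewrite /wdeg mon2_0 mon2_1 mul1n -epq en -mulnA -mulnDr leq_pmul2l //.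
by rewrite mulnC; lia.
Qed.

(* [l] is the linear form whose power is the top form of [f]. *)
Lemma coord_reduction (f : D) n : coord f -> msize f = n.+1 -> (1 < n)%N ->
  exists (t : K) (A l : D) (k e : nat) (q : nat -> K) (f1 : D),
    [/\ (A = y /\ l = x - t *: y) \/ (A = x /\ l = y - t *: x),
        (1 < k)%N /\ n = (k * e)%N, coord f1, msize f1 = e.+1 &
        f = f1 \mPo [tuple A + \sum_(2 <= j < k.+1) q j *: l ^+ j; l]].
Proof.
move=> cf szf n1; have n_gt0 := ltnW n1.
(* This covers both cases below: [l] and [A] are the linear forms that undo the normalization of f
   to F. *)
have main (F A l : D) : coord F -> F@_(mon2 n 0) != 0 ->
    (forall m, m \in msupp F -> m != mon2 n 0 -> (mdeg m < n)%N) ->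
    f = F \mPo [tuple l; A] ->
  exists (k e : nat) (q : nat -> K) (f1 : D),
    [/\ (1 < k)%N /\ n = (k * e)%N, coord f1, msize f1 = e.+1 &
        f = f1 \mPo [tuple A + \sum_(2 <= j < k.+1) q j *: l ^+ j; l]].
  move=> cF Fn ltF ef.
  have [k [e [k1 en cF1 F1e leF1]]] := extremal_edge cF n1 Fn ltF.
  have [q [f1 [cf1 sz1 eF1]]] := descent splitK cF1 (ltnW k1) F1e leF1.
  exists k, e, q, f1; split; [by [] | by [] | by [] |].
  have -> : f = F \mPo [tuple y; x] \mPo [tuple A; l].
    by rewrite comp_mpoly2A comp_mpoly2X comp_mpoly2Y.
  rewrite eF1 comp_mpoly2A comp_mpoly2Y.
  suff -> : (x + \sum_(2 <= j < k.+1) q j *: y ^+ j) \mPo [tuple A; l] =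
            A + \sum_(2 <= j < k.+1) q j *: l ^+ j by [].
  rewrite comp_mpolyD comp_mpoly2X rmorph_sum; congr (_ + _).
  by apply: eq_bigr => j _; rewrite /= comp_mpolyZ rmorphXn /= comp_mpoly2Y.
have unshear (t : K) (h : D) :
    h \mPo [tuple x + t *: y; y] \mPo [tuple x - t *: y; y] = h.
  have [ex _ _ _] := shear_inverse 1 (- t).
  move: ex; rewrite scaleNr opprK !expr1 => ex.
  by rewrite comp_mpoly2A ex comp_mpoly2Y comp_mpoly2_id.
have [fn|fn] := coord_pure_power cf szf n_gt0.
  have [t [cF Fn ltF]] := normalize_top_form cf szf n_gt0 fn.
  have [|k [e [q [f1 [k1 cf1 sz1 ef]]]]] := main _ y (x - t *: y) cF Fn ltF.
    by rewrite unshear.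
  by exists t, y, (x - t *: y), k, e, q, f1; split=> //; left.
(* If y^n occurs instead of x^n, the variables are exchanged first. *)
pose f' := f \mPo [tuple y; x].
have cf' : coord f' by apply: coord_comp (inverse_swap _) cf.
have szf' : msize f' = n.+1 by rewrite /f' msize_swap.
have f'n : f'@_(mon2 n 0) != 0 by rewrite /f' mcoeff_swap mon2_0 mon2_1.
have [t [cF Fn ltF]] := normalize_top_form cf' szf' n_gt0 f'n.
have [|k [e [q [f1 [k1 cf1 sz1 ef]]]]] := main _ x (y - t *: x) cF Fn ltF.
  have -> : f = f' \mPo [tuple y; x].
    by rewrite /f' comp_mpoly2A comp_mpoly2X comp_mpoly2Y comp_mpoly2_id.
  rewrite -{1}(unshear t f') comp_mpoly2A comp_mpoly2Y.
  suff -> : (x - t *: y) \mPo [tuple y; x] = y - t *: x by [].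
  by rewrite comp_mpolyB comp_mpolyZ comp_mpoly2X comp_mpoly2Y.
by exists t, x, (y - t *: x), k, e, q, f1; split=> //; right.
Qed.

End CoordinateReduction.

(** * Polynomial families *)

Lemma eval2_map_mpoly (R S T : comNzRingType) (k : {rmorphism R -> S})
    (h : {rmorphism S -> T}) (a b : T) (f : {mpoly R[2]}) :
  eval2 h a b (map_mpoly k f) = eval2 (h \o k) a b f.
Proof.
apply: (@mpoly_rmorph_ext _ _ _ (eval2 h a b \o map_mpoly k) (eval2 (h \o k) a b)).
  by move=> c /=; rewrite map_mpolyC !eval2C.
move=> i /=; rewrite map_mpolyX.
by case: (ord2P i) => ->; rewrite ?eval2X ?eval2Y.
Qed.

Lemma map_mpoly_comp2 (R S : comNzRingType) (k : {rmorphism R -> S})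
    (f u v : {mpoly R[2]}) :
  map_mpoly k (f \mPo [tuple u; v]) =
  map_mpoly k f \mPo [tuple map_mpoly k u; map_mpoly k v].
Proof.
rewrite !comp_mpoly2E eval2_map_mpoly (rmorph_eval2 _ (map_mpoly k)).
by apply: eq_eval2 => c; rewrite /= map_mpolyC.
Qed.

Section PolynomialFamilies.
Variable K : fieldType.
Local Notation D := {mpoly K[2]}.
Local Notation x := ('X_ord0 : D).
Local Notation y := ('X_ord_max : D).
Implicit Types (t : nat -> K) (M : nat).

Local Notation ev M t := (meval (fun i : 'I_M => t (nat_of_ord i))).

(** Parameters are infinite sequences of which only the first [M] entries matter, so families with
    different numbers of parameters can share one sequence. *)
Definition poly_function M (h : (nat -> K) -> K) : Prop :=
  exists p : {mpoly K[M]}, forall t, h t = ev M t p.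

Definition poly_family M (phi : (nat -> K) -> D) : Prop :=
  exists Phi : {mpoly {mpoly K[M]}[2]}, forall t, phi t = map_mpoly (ev M t) Phi.

Lemma poly_function_const M c : poly_function M (fun=> c).
Proof. by exists c%:MP => t; rewrite mevalC. Qed.

Lemma poly_function_var M i : (i < M)%N -> poly_function M (fun t => t i).
Proof. by move=> lt; exists 'X_(Ordinal lt) => t; rewrite mevalXU. Qed.

Lemma poly_functionN M h : poly_function M h -> poly_function M (fun t => - h t).
Proof. by move=> [p ep]; exists (- p) => t; rewrite ep mevalN. Qed.

Lemma poly_family_const M (p : D) : poly_family M (fun=> p).
Proof.
exists (map_mpoly (@mpolyC M K) p) => t; apply/mpolyP => m.
by rewrite !mcoeff_map_mpoly /= mevalC.
Qed.

Lemma poly_familyD M phi psi : poly_family M phi -> poly_family M psi ->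
  poly_family M (fun t => phi t + psi t).
Proof.
by move=> [p ep] [q eq]; exists (p + q) => t; rewrite ep eq rmorphD.
Qed.

Lemma poly_familyX M phi n : poly_family M phi ->
  poly_family M (fun t => phi t ^+ n).
Proof. by move=> [p ep]; exists (p ^+ n) => t; rewrite ep rmorphXn. Qed.

Lemma poly_familyZ M h phi : poly_function M h -> poly_family M phi ->
  poly_family M (fun t => h t *: phi t).
Proof.
by move=> [c ec] [p ep]; exists (c *: p) => t; rewrite ec ep map_mpolyZ.
Qed.

Lemma poly_family_sum M (s : seq nat) (F : nat -> (nat -> K) -> D) :
  {in s, forall j, poly_family M (F j)} ->
  poly_family M (fun t => \sum_(j <- s) F j t).
Proof.
elim: s => [|j s IHs] Fs.
  by exists 0 => t; rewrite big_nil rmorph0.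
have [|q eq] := IHs; first by move=> i si; apply: Fs; rewrite in_cons si orbT.
have [p ep] := Fs j (mem_head _ _).
by exists (p + q) => t; rewrite big_cons ep eq rmorphD.
Qed.

Lemma poly_family_comp M phi u v :
  poly_family M phi -> poly_family M u -> poly_family M v ->
  poly_family M (fun t => phi t \mPo [tuple u t; v t]).
Proof.
move=> [p ep] [a ea] [b eb]; exists (p \mPo [tuple a; b]) => t.
by rewrite ep ea eb map_mpoly_comp2.
Qed.

Lemma poly_family_subst M M' phi (s : nat -> (nat -> K) -> K) :
  poly_family M phi -> (forall i, (i < M)%N -> poly_function M' (s i)) ->
  poly_family M' (fun t => phi (s^~ t)).
Proof.
move=> [Phi ePhi] sM.
have [p ep] := @fin_all_exists 'I_M (fun=> {mpoly K[M']})
  (fun i p => forall t, s i t = ev M' t p) (fun i => sM i (ltn_ord i)).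
exists (map_mpoly (comp_mpoly [tuple p i | i < M]) Phi) => t.
apply/mpolyP => m; rewrite ePhi !mcoeff_map_mpoly /= comp_mpoly_meval.
by apply: meval_eq => i; rewrite tnth_mktuple ep.
Qed.

Lemma poly_family_ext M phi t t' : poly_family M phi ->
  (forall i, (i < M)%N -> t i = t' i) -> phi t = phi t'.
Proof.
move=> [p ep] tt'; rewrite !ep; apply/mpolyP => m; rewrite !mcoeff_map_mpoly.
by apply: meval_eq => i; apply: tt'.
Qed.

Lemma poly_family_mcoeff M phi m : poly_family M phi ->
  poly_function M (fun t => (phi t)@_m).
Proof.
by move=> [p ep]; exists p@_m => t; rewrite ep mcoeff_map_mpoly.
Qed.

(** By [chain_length_le], such a finite covering bounds the dimension by [M]. *)
Definition covered M (S : D -> Prop) : Prop :=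
  exists (I : finType) (phi : I -> (nat -> K) -> D),
    (forall i, poly_family M (phi i)) /\
    forall f, S f -> exists i t, f = phi i t.

Lemma covered_union M (J : finType) (S : J -> D -> Prop) :
  (forall j, covered M (S j)) -> covered M (fun f => exists j, S j f).
Proof.
move=> covS.
have [I covI] := @fin_all_exists J (fun=> finType) _ covS.
have [phi covphi] := @fin_all_exists J (fun j => I j -> (nat -> K) -> D) _ covI.
exists {j : J & I j}, (fun i => phi (tag i) (tagged i)); split.
  by move=> [j i] /=; have [] := covphi j.
move=> f [j Sjf]; have [_ /(_ f Sjf)[i [t ->]]] := covphi j.
by exists (Tagged (fun j => I j) i), t.
Qed.

Lemma covered_sub M (S S' : D -> Prop) :
  (forall f, S f -> S' f) -> covered M S' -> covered M S.
Proof.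
by move=> SS' [I [phi [famphi covS']]]; exists I, phi; split=> // f /SS'; apply: covS'.
Qed.

Lemma covered0 M : covered M (fun=> False).
Proof. by exists void, (fun=> fun=> 0); split=> // -[]. Qed.

Hypothesis splitK : forall P : {poly K},
  exists s : seq K, P = lead_coef P *: \prod_(z <- s) ('X - z%:P).

Definition coordinate_dim n := if n == 1%N then 3 else (n + 3)%N.

Lemma poly_family_linear (M i : nat) (a b : D) : (i < M)%N ->
  poly_family M (fun t => a - t i *: b).
Proof.
move=> lt; have [p ep] := poly_familyD (poly_family_const M a)
  (poly_familyZ (poly_functionN (poly_function_var lt)) (poly_family_const M b)).
by exists p => t; rewrite -ep scaleNr.
Qed.

Lemma affine_covered : covered 3 (fun f => msize f = 2).
Proof.
pose phi (t : nat -> K) := t 0%N *: (1 : D) + (t 1%N *: x + t 2%N *: y).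
exists unit, (fun=> phi); split=> [_|f szf].
  have var i : (i < 3)%N -> poly_function 3 (fun t => t i) by exact: poly_function_var.
  apply: poly_familyD; first by apply: poly_familyZ (poly_family_const _ _); exact: var.
  by apply: poly_familyD; apply: poly_familyZ (poly_family_const _ _); exact: var.
exists tt, (fun i => if i is i'.+1 then if i' is 0 then f@_U_(ord0) else f@_U_(ord_max)
                     else f@_0%MM).
apply/mpolyP => m; rewrite /phi !mcoeffD !mcoeffZ mcoeff1 !mcoeffX.
have [lt|ge] := ltnP (mdeg m) 2; last first.
  rewrite memN_msupp_eq0; last by apply: msize_mdeg_ge; rewrite szf.
  case: eqP ge => [->|_]; first by rewrite mdeg0.
  case: eqP => [<-|_]; first by rewrite mdeg1.
  case: eqP => [<-|_]; first by rewrite mdeg1.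
  by rewrite !mulr0 !addr0.
have [m0|] := posnP (mdeg m).
  have -> : m = 0%MM by apply/eqP; rewrite -mdeg_eq0 m0.
  by rewrite eqxx !mnm1_eq0 mulr1 !mulr0 !addr0.
move=> gt0; have /mdeg1P[i /eqP ->] : mdeg m == 1%N by lia.
rewrite mnm1_eq0 mulr0 add0r !eq_mnm1.
by case: (ord2P i) => ->; rewrite /= ?mulr1 ?mulr0 ?addr0 ?add0r.
Qed.

(** Strong induction through [coord_reduction]: to the parameters of a coordinate of degree e = n /
    k are added the scalar [t] of the linear form and k - 1 coefficients in degrees 2 to k. The
    finitely many shapes are indexed by k and the type of linear form. *)
Lemma coordinates_covered n : (0 < n)%N ->
  covered (coordinate_dim n) (fun f => coord f /\ msize f = n.+1).
Proof.
elim/ltn_ind: n => n IHn n_gt0.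
have [->|n1] := eqVneq n 1%N; first by apply: covered_sub affine_covered => f [].
have {}n1 : (1 < n)%N by rewrite ltn_neqAle eq_sym n1.
pose S (j : bool * 'I_n.+1) (f : D) := exists (t : K) (A l : D) (k e : nat) (q : nat -> K) (f1 : D),
  [/\ (if j.1 then A = y /\ l = x - t *: y else A = x /\ l = y - t *: x) /\
        (k = j.2 :> nat),
      (1 < k)%N /\ n = (k * e)%N, coord f1, msize f1 = e.+1 &
      f = f1 \mPo [tuple A + \sum_(2 <= j < k.+1) q j *: l ^+ j; l]].
apply: (@covered_sub _ _ (fun f => exists j, S j f)) => [f [cf szf]|].
  have [t [A [l [k [e [q [f1 [Al [k1 en] cf1 sz1 ef]]]]]]]] :=
    coord_reduction splitK cf szf n1.
  have lek : (k < n.+1)%N by rewrite ltnS en leq_pmulr //; lia.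
  by case: Al => Al; [exists (true, Ordinal lek) | exists (false, Ordinal lek)];
     exists t, A, l, k, e, q, f1.
apply: covered_union => -[b k].
(* Values of k that are at most 1 or do not divide n give empty classes. *)
have [k1|k1] := leqP k 1.
  by apply: covered_sub (covered0 _) => f [? [? [? [k' [? [? [? [[_ /= ->]]]]]]]]]; lia.
have [|ndv] := boolP (k %| n)%N; last first.
  apply: covered_sub (covered0 _) => f [? [? [? [k' [e [? [? [[_ /= ->] [_ en]]]]]]]]].
  by case/negP: ndv; apply/dvdnP; exists e; exact: etrans en (mulnC _ _).
case/dvdnP => e en.
have e_gt0 : (0 < e)%N by lia.
have [||I [phi [famphi covphi]]] := IHn e; [nia | by [] |].
set d := coordinate_dim e in famphi.
(* For e at least 2 this is e + k <= e k. For e = 1 equality holds, and the value 3 in degree one is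
   essential. *)
have led : (d + k <= coordinate_dim n)%N.
  rewrite /d /coordinate_dim; have -> : (n == 1%N) = false by lia.
  by case: eqP en => [-> | ]; nia.
pose L (t : nat -> K) : D := if b then x - t d *: y else y - t d *: x.
pose A : D := if b then y else x.
(* Entry [d] holds the scalar of the linear form; the coefficient of its j-th power is entry
   [d + j - 1], so the last one used is [d + k - 1]. *)
exists I, (fun i t => phi i t \mPo
  [tuple A + \sum_(2 <= j < k.+1) t (d + j - 1)%N *: L t ^+ j; L t]); split=> [i|f].
  have famL : poly_family (coordinate_dim n) L.
    by rewrite /L; case: (b); apply: poly_family_linear; lia.
  apply: (poly_family_comp _ _ famL).
    apply: (@poly_family_subst d _ (phi i) (fun i t => t i)) => // j lt.
    by apply: poly_function_var; lia.
  apply: poly_familyD; first exact: poly_family_const.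
  apply: poly_family_sum => j; rewrite mem_index_iota => /andP[j2 jk].
  apply: poly_familyZ; last exact: (poly_familyX j famL).
  by apply: poly_function_var; lia.
move=> [t [A' [l [k' [e' [q [f1 [[Al /= ek] [k'1 en'] cf1 sz1 ->]]]]]]]].
have ee : e' = e.
  have := etrans (esym en') en; move: k'1; rewrite ek; move: (nat_of_ord k) => k0.
  by clear; nia.
rewrite ee in sz1; have [i [t1 ->]] := covphi f1 (conj cf1 sz1).
pose t2 j := if (j < d)%N then t1 j else if j == d then t else q (j - d).+1.
exists i, t2.
have -> : phi i t1 = phi i t2.
  by apply: (poly_family_ext (famphi i)) => j lt; rewrite /t2 lt.
have t2d : t2 d = t by rewrite /t2 ltnn eqxx.
have [-> ->] : A' = A /\ l = L t2 by move: Al; rewrite /A /L t2d; case: (b).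
rewrite ek.
suff -> : \sum_(2 <= j < k.+1) q j *: L t2 ^+ j =
          \sum_(2 <= j < k.+1) t2 (d + j - 1)%N *: L t2 ^+ j by [].
apply: eq_big_nat => j /andP[j2 jk].
congr (_ *: _); rewrite /t2.
have -> : (d + j - 1 < d)%N = false by lia.
have -> : (d + j - 1 == d)%N = false by lia.
by congr q; lia.
Qed.

End PolynomialFamilies.

(** * Algebraic dependence *)

Section LastVariable.
Variables (K : fieldType) (n : nat).
Implicit Types (Q : {mpoly K[n.+1]}).
Local Notation widen := (widen_ord (leqnSn n)).

Lemma mcoeff_muni Q (m : 'X_{1..n}) j :
  ((muni Q)`_j)@_m =
  Q@_[multinom if unlift ord_max i is Some i' then m i' else j | i < n.+1].
Proof.
set mj := [multinom _ | _ < _].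
have mjw i : mj (widen i) = m i.
  rewrite mnmE; have -> : widen i = lift ord_max i.
    by apply/val_inj; rewrite /= /bump leqNgt ltn_ord.
  by rewrite liftK.
have mjm : mj ord_max = j by rewrite mnmE unlift_none.
rewrite [in RHS](mpolyE Q) muniE coef_sum !raddf_sum /=; apply: eq_bigr => k _.
rewrite coefZ coefXn mcoeffZ mcoeffX.
have [ejk|njk] := eqVneq j (k ord_max); last first.
  rewrite mulr0 mcoeff0; case: eqP => [ek|]; last by rewrite mulr0.
  by move: njk; rewrite ek mjm eqxx.
rewrite mulr1 mcoeffZ mcoeffX; congr (_ * (nat_of_bool _)%:R).
apply/eqP/eqP => [em|->].
  apply/mnmP => i; have [i' ->|->] := unliftP ord_max i; last by rewrite mjm -ejk.
  have -> : lift ord_max i' = widen i'.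
    by apply/val_inj; rewrite /= /bump leqNgt ltn_ord.
  by rewrite mjw -em mnmE.
by apply/mnmP => i; rewrite mnmE mjw.
Qed.

Lemma muni_eq0 Q : (muni Q == 0) = (Q == 0).
Proof.
apply/eqP/eqP => [Q0|->]; last exact: muni0.
apply/mpolyP => m; rewrite mcoeff0.
have := mcoeff_muni Q [multinom m (lift ord_max i) | i < n] (m ord_max).
rewrite Q0 coef0 mcoeff0 => ->; congr (_@_ _).
apply/mnmP => i; rewrite mnmE.
by case: unliftP => [i' ->|->] //; rewrite mnmE.
Qed.

Lemma meval_muni Q (g : 'I_n.+1 -> K) :
  Q.@[g] = (map_poly (meval (fun i => g (lift ord_max i))) (muni Q)).[g ord_max].
Proof.
rewrite muniE rmorph_sum /= horner_sum mevalE; apply: eq_bigr => m _.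
rewrite -!mul_polyC !rmorphM /= !map_polyC /= map_polyXn !hornerM !hornerC hornerXn.
rewrite -mul_mpolyC mevalM mevalC mevalX -mulrA; congr (_ * _).
rewrite big_ord_recr /=; congr (_ * _); apply: eq_bigr => i _.
rewrite mnmE; congr (g _ ^+ m _); apply/val_inj => /=; rewrite /bump leqNgt ltn_ord //.
Qed.

End LastVariable.

(** The first hypothesis says that K is infinite. As a polynomial in the last variable, Q has
    coefficients vanishing at every point, and induction applies to them. *)
Lemma meval_eq0 (K : fieldType) n (Q : {mpoly K[n]}) :
  (forall P : {poly K}, (forall a, P.[a] = 0) -> P = 0) ->
  (forall g, Q.@[g] = 0) -> Q = 0.
Proof.
move=> infK; elim: n Q => [|n IHn] Q Q0.
  rewrite [Q]nvar0_mpolyC; have := Q0 (fun=> 0).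
  by rewrite {1}[Q]nvar0_mpolyC mevalC => ->; rewrite mpolyC0.
apply/eqP; rewrite -muni_eq0; apply/eqP/polyP => j; rewrite coef0; apply: IHn => g.
have /infK : forall a, (map_poly (meval g) (muni Q)).[a] = 0.
  move=> a; pose ga (i : 'I_n.+1) := if unlift ord_max i is Some i' then g i' else a.
  have := Q0 ga; rewrite meval_muni {2}/ga unlift_none => e; rewrite -[RHS]e.
  congr (_.[_]); apply/polyP => k; rewrite !coef_map /=; apply: meval_eq => i.
  by rewrite /ga liftK.
by move/(congr1 (fun P : {poly K} => P`_j)); rewrite coef0 coef_map.
Qed.

Section AlgebraicDependence.
Variable K : fieldType.

Lemma msize_mul_le n (p q : {mpoly K[n]}) a b :
  (msize p <= a.+1)%N -> (msize q <= b.+1)%N -> (msize (p * q) <= (a + b).+1)%N.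
Proof.
have [->|p0] := eqVneq p 0; first by rewrite mul0r msize0.
have [->|q0] := eqVneq q 0; first by rewrite mulr0 msize0.
move=> lea leb; rewrite msizeM //.
apply: (@leq_trans (a.+1 + b.+1).-1); last by rewrite addSn addnS.
by rewrite -!subn1 leq_sub2r // leq_add.
Qed.

Lemma msize_exp_le n (p : {mpoly K[n]}) a k :
  (msize p <= a.+1)%N -> (msize (p ^+ k) <= (k * a).+1)%N.
Proof.
move=> lea; elim: k => [|k IHk]; first by rewrite expr0 msize1.
by rewrite exprS mulSn; apply: msize_mul_le.
Qed.

Lemma msize_prod_exp_le n e d s (P : 'I_e -> {mpoly K[n]}) (a : 'I_e -> 'I_s) :
  (forall i, msize (P i) <= d.+1)%N ->
  (msize (\prod_i P i ^+ a i) <= (e * (s * d)).+1)%N.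
Proof.
move=> leP; elim: e P a leP => [|e IHe] P a leP; first by rewrite big_ord0 msize1.
rewrite big_ord_recl mulSn; apply: msize_mul_le; last exact: IHe.
apply: (leq_trans (msize_exp_le (a ord0) (leP ord0))).
by rewrite ltnS leq_mul2r (ltnW (ltn_ord _)) orbT.
Qed.

Lemma card_bmnm_le n B : (#|{: 'X_{1..n < B}}| <= B ^ n)%N.
Proof.
have -> : (B ^ n = #|{ffun 'I_n -> 'I_B}|)%N by rewrite card_ffun !card_ord.
case: B => [|B].
  by rewrite eq_card0 // => m; have := bmdeg m.
have lt (m : 'X_{1..n < B.+1}) i : (m i < B.+1)%N.
  apply: leq_ltn_trans (bmdeg m); rewrite mdegE (bigD1 i) //=; exact: leq_addr.
pose h (m : 'X_{1..n < B.+1}) := [ffun i => Ordinal (lt m i)].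
apply: (@leq_card _ _ h) => m1 m2 /ffunP eqh.
by apply/val_inj/mnmP => i; have := eqh i; rewrite !ffunE => -[].
Qed.

(** By counting: the products of powers of the [P i] with exponents below [s] outnumber the
    monomials that can occur in them, so they are linearly dependent. *)
Lemma algebraic_dependence m e (P : 'I_e -> {mpoly K[m]}) : (m < e)%N ->
  exists2 Q : {mpoly K[e]}, Q != 0 & Q \mPo [tuple P i | i < e] = 0.
Proof.
move=> lt_me.
pose d := (\max_i msize (P i))%N.
have leP i : (msize (P i) <= d.+1)%N by apply: leqW; apply: (leq_bigmax i).
(* This choice gives B^m <= (s (e d + 1))^m < s^(m + 1) <= s^e. *)
pose s := ((e * d + 1) ^ m).+1; pose B := (e * (s * d)).+1.
pose T := {ffun 'I_e -> 'I_s}; pose C := {: 'X_{1..m < B}}.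
have ltCT : (#|C| < #|T|)%N.
  apply: (leq_ltn_trans (card_bmnm_le _ _)); rewrite card_ffun !card_ord.
  apply: (@leq_trans (s ^ m.+1)); last exact: leq_pexp2l.
  apply: (@leq_ltn_trans ((s * (e * d + 1)) ^ m)).
    have [->|m_gt0] := posnP m; first by rewrite !expn0.
    by rewrite leq_exp2r // /B; clear; nia.
  rewrite expnMn expnS mulnC ltn_pmul2r ?expn_gt0 //; exact: ltnSn.
pose W (a : T) := \prod_i P i ^+ a i.
(* Rows are the coefficient vectors of the products, so a left kernel vector is a linear relation
   among them. *)
pose A : 'M[K]_(#|T|, #|C|) := \matrix_(i, j) (W (enum_val i))@_(enum_val j : C).
have : kermx A != 0.
  rewrite -mxrank_eq0 mxrank_ker subn_eq0 -ltnNge.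
  exact: leq_ltn_trans (rank_leq_col A) ltCT.
case/rowV0Pn => r /sub_kermxP rA r0.
pose mon (a : T) : 'X_{1..e} := [multinom (a i : nat) | i < e].
have mon_inj : injective mon.
  move=> a b /mnmP eqm; apply/ffunP => i; apply/val_inj.
  by have := eqm i; rewrite !mnmE.
pose Q := \sum_(i < #|T|) r ord0 i *: 'X_[mon (enum_val i)] : {mpoly K[e]}.
exists Q.
  have [i ri] : exists i, r ord0 i != 0.
    by apply/existsP; apply: contraNT r0 => /existsPn r0; apply/eqP/rowP => i;
       rewrite mxE; apply/eqP/negbNE/r0.
  apply: contraNneq ri => Q0; have := mcoeff0 K (mon (enum_val i)).
  rewrite -Q0 /Q raddf_sum (bigD1 i) //= mcoeffZ mcoeffX eqxx mulr1 big1 ?addr0.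
    by move=> ->.
  move=> j ne; rewrite mcoeffZ mcoeffX (inj_eq mon_inj) (inj_eq enum_val_inj).
  by rewrite (negPf ne) mulr0.
rewrite /Q rmorph_sum /=; apply/mpolyP => k; rewrite mcoeff0 raddf_sum /=.
have PW i : 'X_[mon (enum_val i)] \mPo [tuple P i | i < e] = W (enum_val i).
  by rewrite comp_mpolyX; apply: eq_bigr => j _; rewrite tnth_mktuple mnmE.
under eq_bigr do rewrite comp_mpolyZ PW mcoeffZ.
have [lt|ge] := ltnP (mdeg k) B; last first.
  apply: big1 => i _; rewrite memN_msupp_eq0 ?mulr0 //.
  apply: msize_mdeg_ge; apply: leq_trans ge; exact: msize_prod_exp_le.
have := congr1 (fun v : 'rV_#|C| => v ord0 (enum_rank (BMultinom lt : C))) rA.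
rewrite !mxE => rA0; rewrite -[RHS]rA0; apply: eq_bigr => i _.
by rewrite mxE enum_rankK.
Qed.

End AlgebraicDependence.

(** * Zariski dimension *)

Local Open Scope classical_set_scope.

Lemma closed_field_infinite (K : closedFieldType) (P : {poly K}) :
  (forall a, P.[a] = 0) -> P = 0.
Proof.
move=> P0; apply/eqP; apply: contraT => /closed_nonrootP[a].
by rewrite /root P0 eqxx.
Qed.

Section ZariskiDimension.
Variables (K : closedFieldType) (N : nat).
Implicit Types (S Z : set 'rV[K]_N) (p : {mpoly K[N]}).

Lemma zariski_closure_vanish S p :
  (forall v, S v -> p.@[v ord0] = 0) ->
  forall v, zariski_closure S v -> p.@[v ord0] = 0.
Proof.
move=> pS v Sv.
have : zero_locus [set p] v.
  apply: Sv; split; first by exists [set p].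
  by move=> w Sw q ->; apply: pS.
by apply.
Qed.

Lemma zariski_closed_closure S : zariski_closed (zariski_closure S).
Proof.
exists [set p | forall v, S v -> p.@[v ord0] = 0]; apply/seteqP; split.
  by move=> v Sv p pS; apply: zariski_closure_vanish Sv.
move=> v vI Z [[I ->] SI] p Ip; apply: vI => w Sw.
exact: SI Ip.
Qed.

(** Induction on [e]: a relation on [C e.+1] is a polynomial in the last function [f e]. Its
    constant coefficient vanishes on [C e], where [f e] does, so it is zero by induction; a factor
    [f e] is then cancelled by irreducibility of [C e.+1]. *)
Lemma chain_independent (C : nat -> set 'rV[K]_N) (f : nat -> {mpoly K[N]}) d :
    (forall i, (i <= d)%N -> zariski_irreducible (C i)) ->
    (forall i, (i < d)%N -> C i `<=` C i.+1) ->
    (forall i, (i < d)%N -> forall v, C i v -> (f i).@[v ord0] = 0) ->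
    (forall i, (i < d)%N -> ~ forall v, C i.+1 v -> (f i).@[v ord0] = 0) ->
  forall e (Q : {mpoly K[e]}), (e <= d)%N ->
    (forall v, C e v -> Q.@[fun i => (f (nat_of_ord i)).@[v ord0]] = 0) -> Q = 0.
Proof.
move=> irrC CS fC nfC; elim=> [|e IHe] Q led QC.
  have [[v Cv] _] := irrC 0%N isT; have := QC v Cv.
  by rewrite [Q]nvar0_mpolyC mevalC => ->; rewrite mpolyC0.
apply/eqP; rewrite -muni_eq0; apply/eqP.
pose F (v : 'rV[K]_N) (i : 'I_e) := (f (nat_of_ord i)).@[v ord0].
have {}QC v : C e.+1 v -> (map_poly (meval (F v)) (muni Q)).[(f e).@[v ord0]] = 0.
  move=> /QC; rewrite meval_muni => eQ; rewrite -[RHS]eQ; congr (_.[_]).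
  apply/polyP => k; rewrite !coef_map /=; apply: meval_eq => i.
  by rewrite /F /= /bump leqNgt ltn_ord.
move: (muni Q) QC; elim/poly_ind => [//|U c IHU] UC.
have UcE v : (map_poly (meval (F v)) (U * 'X + c%:P)).[(f e).@[v ord0]] =
    (map_poly (meval (F v)) U).[(f e).@[v ord0]] * (f e).@[v ord0] + c.@[F v].
  by rewrite rmorphD rmorphM /= map_polyX map_polyC hornerMXaddC.
have c0 : c = 0.
  apply: IHe (ltnW led) _ => v Cv.
  have := UC v (CS _ led _ Cv); rewrite UcE (fC _ led v Cv) mulr0 add0r.
  exact.
rewrite c0 addr0 IHU ?mul0r // => v Cv.
(* [R] is the cofactor of [f e] as a polynomial on the affine space, so its zero set is closed and
   irreducibility can be applied. *)
pose R := (map_poly (comp_mpoly [tuple f (nat_of_ord i) | i < e]) U).[f e].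
have RE (w : 'rV[K]_N) : R.@[w ord0] = (map_poly (meval (F w)) U).[(f e).@[w ord0]].
  rewrite /R -horner_map -map_poly_comp /=; congr (_.[_]).
  apply/polyP => k; rewrite !coef_map /= comp_mpoly_meval; apply: meval_eq => i.
  by rewrite tnth_mktuple.
have [_ irr] := irrC _ led.
have [|||ZA|ZB] := irr (zero_locus [set f e]) (zero_locus [set R]).
- by exists [set f e].
- by exists [set R].
- move=> w Cw; have := UC w Cw; rewrite UcE c0 meval0 addr0 -RE => /eqP.
  rewrite mulf_eq0 => /orP[/eqP e0|/eqP e0]; [right|left] => q ->; exact: e0.
- by case: (nfC _ led) => w /ZA; apply.
by rewrite -RE; apply: (ZB v Cv).
Qed.

(** On each family, M + 1 functions in M parameters satisfy a nontrivial relation. The product of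
    these relations over the finitely many families vanishes on the closure of [S], against
    independence along a longer chain. *)
Lemma chain_length_le M S (I : finType) (c : I -> 'I_N -> {mpoly K[M]}) e :
    (forall v, S v -> exists i (t : 'I_M -> K), forall j, v ord0 j = (c i j).@[t]) ->
    has_irreducible_chain (zariski_closure S) e -> (e <= M)%N.
Proof.
move=> covS [C [chain CS]]; rewrite leqNgt; apply/negP => ltMe.
(* [C i] is closed and strictly contained in [C i.+1], so one of its equations fails on the
   latter. *)
have exf i : exists p : {mpoly K[N]}, (i < e)%N ->
    (forall v, C i v -> p.@[v ord0] = 0) /\
    ~ (forall v, C i.+1 v -> p.@[v ord0] = 0).
  have [lt|_] := boolP (i < e)%N; last by exists 0.
  have [[J CJ] _ _] := chain i (ltnW lt).
  have [_ nCS] := CS i lt; apply: contrapT => nf; apply: nCS => v Cv.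
  rewrite CJ => p Jp; apply: contrapT => pv; apply: nf; exists p => _; split.
    by move=> w; rewrite CJ => /(_ p Jp).
  by move=> /(_ v Cv).
have [f fC] := choice exf.
pose P i (k : 'I_M.+1) := f (nat_of_ord k) \mPo [tuple c i j | j < N].
have exQ i : exists Q : {mpoly K[M.+1]},
    Q != 0 /\ Q \mPo [tuple P i k | k < M.+1] = 0.
  by have [Q Q0 QP] := algebraic_dependence (P i) (ltnSn M); exists Q.
have [Q QP] := fin_all_exists exQ.
have Q0 : \prod_i Q i = 0; last first.
  by move/eqP: Q0; rewrite prodf_seq_eq0 => /hasP[i _ /=]; have [/negPf->] := QP i.
apply: (@chain_independent C f e _ _ _ _ _ _ ltMe) => [i /chain[] //|i /CS[] //|||].
- by move=> i /fC[].
- by move=> i /fC[].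
move=> v Cv; pose R := (\prod_i Q i) \mPo [tuple f (nat_of_ord k) | k < M.+1].
have RE (w : 'rV[K]_N) : R.@[w ord0] =
    (\prod_i Q i).@[fun k : 'I_M.+1 => (f (nat_of_ord k)).@[w ord0]].
  by rewrite comp_mpoly_meval; apply: meval_eq => k; rewrite tnth_mktuple.
rewrite -RE; have [_ _ /(_ v Cv)] := chain _ ltMe; apply: zariski_closure_vanish.
move=> w /covS[i [t wE]]; rewrite RE rmorph_prod; apply/eqP.
apply/prodf_eq0; exists i => //; have [_ QPi] := QP i.
have := congr1 (meval t) QPi; rewrite meval0 comp_mpoly_meval => <-.
apply/eqP/meval_eq => k; rewrite tnth_mktuple comp_mpoly_meval.
by apply: meval_eq => j; rewrite tnth_mktuple.
Qed.

End ZariskiDimension.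

(** * Closures of polynomial images of affine space *)

Section PolynomialImages.
Variables (K : closedFieldType) (N M : nat) (V : (nat -> K) -> 'rV[K]_N).
Hypothesis polyV : forall j, poly_function M (fun t => V t ord0 j).
Local Notation ev t := (meval (fun i : 'I_M => t (nat_of_ord i))).

Lemma poly_function_pullback (p : {mpoly K[N]}) :
  exists P : {mpoly K[M]}, forall t, p.@[V t ord0] = ev t P.
Proof.
have [c cE] := fin_all_exists polyV.
exists (p \mPo [tuple c j | j < N]) => t; rewrite comp_mpoly_meval.
by apply: meval_eq => j; rewrite tnth_mktuple cE.
Qed.

Lemma ev_eq0 (P : {mpoly K[M]}) : (forall t : nat -> K, ev t P = 0) -> P = 0.
Proof.
move=> P0; apply: meval_eq0; first exact: closed_field_infinite.
move=> g; have := P0 (fun i => if insub i is Some j then g j else 0).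
by move=> e; rewrite -[RHS]e; apply: meval_eq => i; rewrite valK.
Qed.

(** A polynomial vanishing on [S] pulls back to some P that vanishes off the hypersurface h = 0.
    Hence P h = 0, and P = 0 in the domain of polynomials. *)
Lemma zariski_closure_image_sub (S : set 'rV[K]_N) (h : {mpoly K[M]}) :
    h != 0 -> (forall t, ev t h != 0 -> S (V t)) ->
  zariski_closure (range V) `<=` zariski_closure S.
Proof.
move=> h0 hS; apply: smallest_sub; first exact: zariski_closed_closure.
move=> _ [t _ <-] Z [[I ->] SI] p Ip.
have [P PE] := poly_function_pullback p.
suff P0 : P = 0 by rewrite PE P0 meval0.
have : P * h = 0.
  apply: ev_eq0 => u; rewrite mevalM; have [->|hu] := eqVneq (ev u h) 0.
    by rewrite mulr0.
  by rewrite -PE (SI _ (hS _ hu) p Ip) mul0r.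
by move/eqP; rewrite mulf_eq0 (negPf h0) orbF => /eqP.
Qed.

(** Equations of [A] and [B] that fail somewhere on the image pull back to nonzero polynomials whose
    product is zero, which is impossible in a domain. *)
Lemma zariski_closure_image_irreducible :
  zariski_irreducible (zariski_closure (range V)).
Proof.
split.
  by exists (V (fun=> 0)); apply: sub_gen_smallest; exists (fun=> 0).
move=> A B [I EA] [J EB] ZAB.
have sub (L : set {mpoly K[N]}) : (forall p, L p -> forall t, p.@[V t ord0] = 0) ->
    zariski_closure (range V) `<=` zero_locus L.
  by move=> L0; apply: smallest_sub; [exists L | move=> _ [t _ <-] p /L0].
apply: contrapT => /not_orP[nA nB].
have [p Ip [t pt]] : exists2 p, I p & exists t, p.@[V t ord0] <> 0.
  apply: contrapT => no; apply: nA; rewrite EA; apply: sub => p Ip t.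
  by apply: contrapT => pt; apply: no; exists p => //; exists t.
have [q Jq [u qu]] : exists2 q, J q & exists t, q.@[V t ord0] <> 0.
  apply: contrapT => no; apply: nB; rewrite EB; apply: sub => q Jq u.
  by apply: contrapT => qu; apply: no; exists q => //; exists u.
have [P PE] := poly_function_pullback p; have [Q QE] := poly_function_pullback q.
have : P * Q = 0.
  apply: ev_eq0 => w; rewrite mevalM -PE -QE.
  have : (A `|` B) (V w) by apply: ZAB; apply: sub_gen_smallest; exists w.
  by rewrite EA EB => -[/(_ p Ip)|/(_ q Jq)] ->; rewrite ?mul0r ?mulr0.
move/eqP; rewrite mulf_eq0 => /orP[/eqP P0|/eqP Q0].
  by apply: pt; rewrite PE P0 meval0.
by apply: qu; rewrite QE Q0 meval0.
Qed.

End PolynomialImages.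

Definition truncate (K : fieldType) (i : nat) (t : nat -> K) (j : nat) : K :=
  if (j < i)%N then t j else 0.

Section DimensionOfFamily.
Variables (K : closedFieldType) (n M : nat) (phi : (nat -> K) -> {mpoly K[2]}).
Hypothesis phiP : poly_family M phi.
Local Notation ev t := (meval (fun i : 'I_M => t (nat_of_ord i))).

(* Switching on the parameters one at a time gives the chain of irreducible
   closed sets; [mon i] is a monomial that only appears at the (i+1)-st step. *)
Lemma zariski_dim_family (S : {mpoly K[2]} -> Prop) (h : {mpoly K[M]})
    (mon : nat -> 'X_{1..2}) :
    h != 0 -> (forall t, ev t h != 0 -> S (phi t)) -> covered M S ->
    (forall i, (i < M)%N -> (mdeg (mon i) < n.+1)%N) ->
    (forall i, (i < M)%N -> forall t, (phi (truncate i t))@_(mon i) = 0) ->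
    (forall i, (i < M)%N -> exists t, (phi (truncate i.+1 t))@_(mon i) != 0) ->
  zariski_dim_is [set coef_vector n f | f in [set f | S f]] M.
Proof.
move=> h0 hS [I [psi [psiP covS]]] mon_lt mon0 mon1; split; last first.
  have [c cE] : exists c : I -> 'I_(coef_space_dim n) -> {mpoly K[M]},
      forall i j t, coef_vector n (psi i t) ord0 j = ev t (c i j).
    have cE i := fin_all_exists (fun j => poly_family_mcoeff
      (bmnm (enum_val (j : 'I_(coef_space_dim n)))) (psiP i)).
    have [c {}cE] := fin_all_exists cE; exists c => i j t.
    by rewrite mxE cE.
  move=> e; apply: (@chain_length_le K _ M _ I c) => v [f /covS[i [t ->]] <-].
  by exists i, (fun k => t (nat_of_ord k)) => j; rewrite cE.
pose V i t := coef_vector n (phi (truncate i t)).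
have fam i : poly_family M (fun t => phi (truncate i t)).
  apply: (@poly_family_subst K M M phi (fun j t => truncate i t j)) => // k lt.
  rewrite /truncate; case: (k < i)%N; first exact: poly_function_var.
  exact: poly_function_const.
have poly_coef (psi' : (nat -> K) -> {mpoly K[2]}) : poly_family M psi' ->
    forall j, poly_function M (fun t => coef_vector n (psi' t) ord0 j).
  move=> fam' j; have [p pE] := poly_family_mcoeff (bmnm (enum_val j)) fam'.
  by exists p => t; rewrite mxE pE.
have closureS (A B : set 'rV[K]_(coef_space_dim n)) :
    A `<=` B -> zariski_closure A `<=` zariski_closure B.
  by move=> AB; apply: sub_smallest2r => //; exact: zariski_closed_closure.
(* All members lie in the closure of the full family, which lies in that of [S] because parameters
   with [h] nonzero are generic. *)
exists (fun i => zariski_closure (range (V i))); split=> i lti.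
  split; [exact: zariski_closed_closure | |].
    apply: (@zariski_closure_image_irreducible K _ M (V i)).
    exact: (poly_coef _ (fam i)).
  apply: (subset_trans (B := zariski_closure (range (fun t => coef_vector n (phi t))))).
    by apply: closureS => _ [t _ <-]; exists (truncate i t).
  apply: (@zariski_closure_image_sub K _ M _ (poly_coef _ phiP) _ h h0) => t ht.
  by exists (phi t) => //; exact: hS.
split.
  apply: closureS => _ [t _ <-]; exists (truncate i t) => //.
  rewrite /V; congr (coef_vector n (phi _)); apply/funext => j.
  by rewrite /truncate; case: (ltnP j i) => [lt|]; [rewrite ltnS ltnW | case: (j < i.+1)%N].
(* The coefficient at [mon i] vanishes on the [i]-th closure but not on the next one, so the
   inclusion is strict. *)
move=> sub; have [t tn] := mon1 i lti.
pose k : 'I_(coef_space_dim n) := enum_rank (BMultinom (mon_lt i lti)).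
have kE f : (coef_vector n f) ord0 k = f@_(mon i) by rewrite mxE enum_rankK.
have := @zariski_closure_vanish K _ (range (V i)) 'X_k _ (V i.+1 t) _.
rewrite mevalXU kE => X0; move/eqP: tn; apply; apply: X0.
  by move=> _ [u _ <-]; rewrite mevalXU kE mon0.
by apply: sub; apply: sub_gen_smallest; exists t.
Qed.

End DimensionOfFamily.

(** * The coordinates e y + P(x + b y) *)

Section LengthOneCoordinates.
Variable K : fieldType.
Local Notation D := {mpoly K[2]}.
Local Notation x := ('X_ord0 : D).
Local Notation y := ('X_ord_max : D).

Definition length_one n (e b : K) (c : nat -> K) : D :=
  e *: y + \sum_(0 <= j < n.+1) c j *: (x + b *: y) ^+ j.

Lemma coord_length_one n e b c : e != 0 -> coord (length_one n e b c).
Proof.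
move=> e0; pose Q (a : D) := \sum_(0 <= j < n.+1) c j *: a ^+ j.
have Qcomp a u v : Q a \mPo [tuple u; v] = Q (a \mPo [tuple u; v]).
  by rewrite /Q rmorph_sum; apply: eq_bigr => j _; rewrite /= comp_mpolyZ rmorphXn.
have -> : length_one n e b c = (e *: y + Q x) \mPo [tuple x + b *: y; y].
  by rewrite comp_mpolyD comp_mpolyZ comp_mpoly2Y Qcomp comp_mpoly2X.
apply: (coord_comp (shear_inverse 1 b)).
(* The partner of e y + Q(x) is x, and the inverse is (y, (x - Q(y)) / e). *)
exists x, y, (e^-1 *: (x - Q y)); split.
- exact: comp_mpoly2Y.
- rewrite comp_mpolyZ comp_mpolyB comp_mpoly2X Qcomp comp_mpoly2Y addrK scalerA.
  by rewrite mulVf // scale1r.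
- rewrite comp_mpolyD comp_mpolyZ comp_mpoly2Y Qcomp comp_mpoly2X scalerA.
  by rewrite mulfV // scale1r subrK.
exact: comp_mpoly2X.
Qed.

Lemma mcoeff_y_exp (c : K) j m : (c *: y ^+ j)@_(mon2 0 m) = c * (j == m)%:R.
Proof.
rewrite mcoeffZ; have -> : y ^+ j = 'X_[mon2 0 j].
  by rewrite (mpolyX2E _ (mon2 _ _)) mon2_0 mon2_1 expr0 mul1r.
rewrite mcoeffX; congr (_ * (nat_of_bool _)%:R); apply/eqP/eqP => [|-> //].
by move/(congr1 (fun k : 'X_{1..2} => k ord_max)); rewrite !mon2_1.
Qed.

Lemma mcoeff_length_one_x n e b c m : (m <= n)%N ->
  (length_one n e b c)@_(mon2 m 0) = c m.
Proof.
move=> le; have -> : mon2 m 0 = mon2 (mon2 0 m ord_max) (mon2 0 m ord0).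
  by rewrite mon2_0 mon2_1.
rewrite -mcoeff_swap -mcoeff_restrict_y comp_mpoly2A comp_mpoly2X comp_mpoly2Y.
rewrite comp_mpolyD comp_mpolyZ comp_mpoly2Y scaler0 add0r rmorph_sum raddf_sum /=.
have term j : ((c j *: (x + b *: y) ^+ j) \mPo [tuple y; 0])@_(mon2 0 m) =
    c j * (j == m)%:R.
  rewrite comp_mpolyZ rmorphXn /= comp_mpolyD comp_mpoly2X comp_mpolyZ comp_mpoly2Y.
  by rewrite scaler0 addr0 mcoeff_y_exp.
rewrite (bigD1_seq m) ?iota_uniq //=; last by rewrite mem_index_iota.
rewrite term eqxx mulr1 big1 ?addr0 // => j ne.
by rewrite term (negPf ne) mulr0.
Qed.

Lemma mcoeff_length_one_y n e b c m : (m <= n)%N ->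
  (length_one n e b c)@_(mon2 0 m) = e * (1 == m)%:R + c m * b ^+ m.
Proof.
move=> le; rewrite -mcoeff_restrict_y comp_mpolyD comp_mpolyZ comp_mpoly2Y mcoeffD.
rewrite -[y in e *: y]expr1 mcoeff_y_exp; congr (_ + _).
rewrite rmorph_sum raddf_sum /=.
have term j : ((c j *: (x + b *: y) ^+ j) \mPo [tuple 0; y])@_(mon2 0 m) =
    c j * b ^+ j * (j == m)%:R.
  rewrite comp_mpolyZ rmorphXn /= comp_mpolyD comp_mpoly2X comp_mpolyZ comp_mpoly2Y.
  by rewrite add0r exprZn scalerA mcoeff_y_exp.
rewrite (bigD1_seq m) ?iota_uniq //=; last by rewrite mem_index_iota.
rewrite term eqxx mulr1 big1 ?addr0 // => j ne.
by rewrite term (negPf ne) mulr0.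
Qed.

Lemma msize_length_one n e b c : (0 < n)%N ->
  (length_one n e b c)@_(mon2 n 0) != 0 \/ (length_one n e b c)@_(mon2 0 n) != 0 ->
  msize (length_one n e b c) = n.+1.
Proof.
move=> n0 nz; apply/eqP; rewrite eqn_leq; apply/andP; split; last first.
  case: nz; rewrite -mcoeff_msupp => /msize_mdeg_lt;
    by rewrite mdeg2E mon2_0 mon2_1 ?addn0 ?add0n.
apply: (leq_trans (msizeD_le _ _)); rewrite geq_max; apply/andP; split.
  by apply: (leq_trans (msizeZ_le _ _)); rewrite msizeX mdeg1.
apply: (leq_trans (msize_sum _ _ _)); apply/bigmax_leqP_seq => j.
rewrite mem_index_iota ltnS => /andP[_ lej] _.
apply: (leq_trans (msizeZ_le _ _)).
apply: (leq_trans (@msize_exp_le _ _ _ 1 j _)); last by rewrite muln1.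
apply: (leq_trans (msizeD_le _ _)); rewrite geq_max msizeX mdeg1 /=.
by apply: (leq_trans (msizeZ_le _ _)); rewrite msizeX mdeg1.
Qed.

Lemma poly_family_length_one M n e b c : poly_function M e -> poly_function M b ->
  (forall j, (j < n.+1)%N -> poly_function M (c^~ j)) ->
  poly_family M (fun t => length_one n (e t) (b t) (c t)).
Proof.
move=> eP bP cP; apply: poly_familyD.
  by apply: poly_familyZ => //; exact: poly_family_const.
apply: poly_family_sum => j; rewrite mem_index_iota => /andP[_ ltj].
apply: (poly_familyZ (cP j ltj)); apply: poly_familyX.
apply: poly_familyD; first exact: poly_family_const.
by apply: (poly_familyZ bP); exact: poly_family_const.
Qed.

End LengthOneCoordinates.

(** * Dimension of the sets of coordinates *)

Lemma closed_field_split (K : closedFieldType) (P : {poly K}) :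
  exists s : seq K, P = lead_coef P *: \prod_(z <- s) ('X - z%:P).
Proof. by have [s] := closed_field_poly_normal P; exists s. Qed.

Lemma is_coordinate_covered (K : closedFieldType) n : (0 < n)%N ->
  covered (coordinate_dim n)
    (fun f : {mpoly K[2]} => is_coordinate f /\ msize f = n.+1).
Proof.
move=> n_gt0; apply: (covered_sub _ (coordinates_covered (@closed_field_split K) n_gt0)).
by move=> f [/coordinateP].
Qed.

Lemma zariski_dim_coordinates (K : closedFieldType) n : (1 < n)%N ->
  zariski_dim_is (coordinates_of_degree K n) (n + 3).
Proof.
move=> n1; have n_gt0 := ltnW n1.
have dimE : coordinate_dim n = (n + 3)%N by rewrite /coordinate_dim gtn_eqF.
(* The order of the parameters is c_n, b, e, c_(n-1), ..., c_0. The top coefficient comes first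
   because b becomes visible only through the coefficient c_n b^n of y^n. *)
pose c (t : nat -> K) j := if j == n then t 0%N else t (n + 2 - j)%N.
pose phi (t : nat -> K) := length_one n (t 2%N) (t 1%N) (c t).
have var i : (i < n + 3)%N -> poly_function (n + 3) (fun t : nat -> K => t i).
  exact: poly_function_var.
have famphi : poly_family (n + 3) phi.
  apply: poly_family_length_one; [apply: var; lia | apply: var; lia |].
  by move=> j ltj; rewrite /c; case: (j == n); apply: var; lia.
have lt0 : (0 < n + 3)%N by rewrite addnS.
have lt2 : (2 < n + 3)%N by rewrite !addnS !ltnS leq0n.
(* The monomials are x^n, y^n, y, and then x^(n-1) down to 1. The coefficient of y is e + c_1 b, and
   c_1 is still zero when e is switched on. *)
pose mon i := if i == 0%N then mon2 n 0 else if i == 1%N then mon2 0 n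
  else if i == 2 then mon2 0 1 else mon2 (n + 2 - i) 0.
apply: (@zariski_dim_family K n (n + 3) phi famphi _
   ('X_(Ordinal lt0) * 'X_(Ordinal lt2)) mon).
(* The generic condition is c_n e != 0: it ensures degree n and invertibility. *)
- by rewrite mulf_neq0 // -msize_poly_eq0 msizeX.
- move=> t; rewrite mevalM !mevalXU /= mulf_eq0 negb_or => /andP[t0 t2]; split.
    by apply/coordinateP; exact: coord_length_one.
  apply: msize_length_one => //; left.
  by rewrite mcoeff_length_one_x // /c eqxx.
- by rewrite -dimE; exact: is_coordinate_covered.
- by move=> [|[|[|i]]] lti; rewrite mdeg2E /mon /= mon2_0 mon2_1; lia.
- move=> [|[|[|i]]] lti t; rewrite /mon /=.
  + by rewrite mcoeff_length_one_x // /c eqxx.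
  + rewrite mcoeff_length_one_y // (ltn_eqF n1) mulr0 add0r.
    by rewrite [truncate 1 t 1]/truncate /= expr0n gtn_eqF // mulr0.
  + rewrite mcoeff_length_one_y // /c (ltn_eqF n1) [truncate 2 t 2]/truncate /= mul0r add0r.
    by rewrite {1}/truncate (_ : (_ < 2)%N = false) ?mul0r //; lia.
  rewrite mcoeff_length_one_x /c; last by lia.
  rewrite (_ : (_ == n) = false); last by lia.
  by rewrite /truncate (_ : (_ < i.+3)%N = false) //; lia.
move=> [|[|[|i]]] lti; exists (fun=> 1); rewrite /mon /=.
- by rewrite mcoeff_length_one_x // /c eqxx oner_neq0.
- rewrite mcoeff_length_one_y // (ltn_eqF n1) mulr0 add0r /c eqxx /truncate /=.
  by rewrite expr1n mulr1 oner_neq0.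
- rewrite mcoeff_length_one_y // /c (ltn_eqF n1) [truncate 3 _ 2]/truncate /= mul1r.
  by rewrite {1}/truncate (_ : (_ < 3)%N = false) ?mul0r ?addr0 ?oner_neq0 //; lia.
rewrite mcoeff_length_one_x /c; last by lia.
rewrite (_ : (_ == n) = false); last by lia.
by rewrite /truncate (_ : (_ < i.+4)%N = true) ?oner_neq0 //; lia.
Qed.

Lemma zariski_dim_affine_coordinates (K : closedFieldType) :
  zariski_dim_is (coordinates_of_degree K 1) 3.
Proof.
(* In degree one, e and b enter only through the coefficient e + c_1 b of y; setting b = 0 leaves
   three parameters. *)
pose phi (t : nat -> K) := length_one 1 (t 2%N) 0 t.
have var i : (i < 3)%N -> poly_function 3 (fun t : nat -> K => t i).
  exact: poly_function_var.
have famphi : poly_family 3 phi.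
  apply: poly_family_length_one; [exact: var | exact: poly_function_const |].
  by move=> j ltj; apply: var; lia.
pose mon i := if i == 0%N then mon2 0 0 else if i == 1%N then mon2 1 0 else mon2 0 1.
have coef_y t : (phi t)@_(mon2 0 1) = t 2%N.
  by rewrite mcoeff_length_one_y // expr1 mulr0 addr0 mulr1.
apply: (@zariski_dim_family K 1 3 phi famphi _ 'X_(Ordinal (ltnSn 2)) mon).
- by rewrite -msize_poly_eq0 msizeX.
- move=> t; rewrite mevalXU /= => t2; split.
    by apply/coordinateP; exact: coord_length_one.
  by apply: msize_length_one => //; right; rewrite coef_y.
- exact: (@is_coordinate_covered K 1).
- by move=> [|[|[|]]] //; rewrite mdeg2E mon2_0 mon2_1.
- by move=> [|[|[|]]] // _ t; rewrite /mon /= ?coef_y ?mcoeff_length_one_x.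
move=> [|[|[|]]] // _; exists (fun=> 1);
  by rewrite /mon /= ?coef_y ?mcoeff_length_one_x // /truncate /= oner_neq0.
Qed.

Theorem theorem1p3 (K : closedFieldType) :
  (forall n : nat, (2 <= n)%N ->
     zariski_dim_is (coordinates_of_degree K n) (n + 3)%N) /\
  zariski_dim_is (coordinates_of_degree K 1) 3.
Proof.
by split; [exact: zariski_dim_coordinates | exact: zariski_dim_affine_coordinates].
Qed.
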